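(* The class-guided functional $\mathcal{F}_{\mathrm{G}}$ is convex on $\Pi(\mathbb{P})$, lower semi-continuous on $\Pi(\mathbb{P})$, and separably $*$-increasing.
   Context: Let $\mathcal{X}=\mathcal{Y}\subset\mathbb{R}^D$ be compact. Let $\mathbb{P}=\sum_{n=1}^N\alpha_n\mathbb{P}_n\in\mathcal{P}(\mathcal{X})$ and $\mathbb{Q}=\sum_{n=1}^N\beta_n\mathbb{Q}_n\in\mathcal{P}(\mathcal{Y})$ with $\mathbb{P}_n\in\mathcal{P}(\mathcal{X})$, $\mathbb{Q}_n\in\mathcal{P}(\mathcal{Y})$, $\alpha_n,\beta_n\ge0$, $\sum_n\alpha_n=\sum_n\beta_n=1$. $\Pi(\mathbb{P})$ is the set of probability measures on $\mathcal{X}\times\mathcal{Y}$ with first marginal $\mathbb{P}$; lower semi-continuity is w.r.t. the weak topology. Let $\mathcal{Z}=\mathbb{R}^Z$, $\mathbb{S}\in\mathcal{P}(\mathcal{Z})$ atomless. For $\pi\in\Pi(\mathbb{P})$ let $T_\pi:\mathcal{X}\times\mathcal{Z}\to\mathcal{Y}$ be any measurable map with $T_\pi(x,\cdot)_\#\mathbb{S}=\pi(\cdot|x)$ for $\mathbb{P}$-a.e. $x$; then $T_\pi\sharp(\mathbb{P}_n\times\mathbb{S})$ denotes the law of $T_\pi(X,Z)$ with $X\sim\mathbb{P}_n$, $Z\sim\mathbb{S}$ independent. The squared energy distance between $\mu,\nu\in\mathcal{P}(\mathcal{Y})$ is $\mathcal{E}^2(\mu,\nu)=\mathbb{E}\|Y_1-Y_2\|_2-\frac12\mathbb{E}\|Y_1-Y_1'\|_2-\frac12\mathbb{E}\|Y_2-Y_2'\|_2$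 with $Y_1,Y_1'\sim\mu$, $Y_2,Y_2'\sim\nu$ independent. Define $\mathcal{F}_{\mathrm{G}}(\pi)=\sum_{n=1}^N\alpha_n\mathcal{E}^2\big(T_\pi\sharp(\mathbb{P}_n\times\mathbb{S}),\mathbb{Q}_n\big)$ for $\pi\in\Pi(\mathbb{P})$ and $\mathcal{F}_{\mathrm{G}}(\pi)=+\infty$ for $\pi\in\mathcal{M}(\mathcal{X}\times\mathcal{Y})\setminus\Pi(\mathbb{P})$. Convex conjugate: $\mathcal{F}^*(h)=\sup_{\pi\in\mathcal{M}(\mathcal{X}\times\mathcal{Y})}[\int h\,d\pi-\mathcal{F}(\pi)]$ for $h\in\mathcal{C}(\mathcal{X}\times\mathcal{Y})$; $\mathcal{F}$ is separably $*$-increasing if for all $u\in\mathcal{C}(\mathcal{X}),v\in\mathcal{C}(\mathcal{Y}),c\in\mathcal{C}(\mathcal{X}\times\mathcal{Y})$ with $u(x)+v(y)\le c(x,y)$ pointwise, $\mathcal{F}^*(u\oplus v)\le\mathcal{F}^*(c)$, where $(u\oplus v)(x,y)=u(x)+v(y)$. *)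

(* Defs.v *)
From HB Require Import structures.
From mathcomp Require Import all_boot all_order all_algebra.
From mathcomp Require Import all_classical all_reals all_analysis.
From mathcomp Require Import measurable_realfun.
Set Implicit Arguments. Unset Strict Implicit. Unset Printing Implicit Defensive.
Import Order.TTheory GRing.Theory Num.Theory.
Import numFieldNormedType.Exports.
Local Open Scope classical_set_scope.
Local Open Scope ring_scope.

(* R^n is represented by row vectors 'rV[R]_n (normed/topological structure from
   the library).  We equip it with the product (= Borel) sigma-algebra generated
   by the coordinate maps, exactly as the library does for n.-tuple R. *)
Section rV_measurable.
Context (R : realType) (n : nat).
Let coor : 'I_n -> 'rV[R]_n -> R := fun i x => x ord0 i.
Let rV_set0 : g_sigma_preimage coor set0.
Proof. exact: sigma_algebra0. Qed.
Let rV_setC A : g_sigma_preimage coor A -> g_sigma_preimage coor (~` A).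
Proof. exact: sigma_algebraC. Qed.
Let rV_bigcup (F : _^nat) : (forall i, g_sigma_preimage coor (F i)) ->
  g_sigma_preimage coor (\bigcup_i (F i)).
Proof. exact: sigma_algebra_bigcup. Qed.
HB.instance Definition _ := @isMeasurable.Build default_measure_display
  'rV[R]_n (g_sigma_preimage coor) rV_set0 rV_setC rV_bigcup.
End rV_measurable.

Section defs.
Context (R : realType).
Local Notation vec n := 'rV[R]_n.

Definition norm2 n (y : vec n) : R := Num.sqrt (\sum_(i < n) y ord0 i ^+ 2).

(* squared energy distance E^2(mu, nu) = E||Y1-Y2|| - 1/2 E||Y1-Y1'|| - 1/2 E||Y2-Y2'||
   (expectations over independent copies, written as iterated integrals) *)
Definition energy2 n (mu nu : set (vec n) -> \bar R) : \bar R :=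
  ((\int[mu]_y1 \int[nu]_y2 (norm2 (y1 - y2))%:E)
   - (2^-1)%:E * (\int[mu]_y1 \int[mu]_y1' (norm2 (y1 - y1'))%:E)
   - (2^-1)%:E * (\int[nu]_y2 \int[nu]_y2' (norm2 (y2 - y2'))%:E))%E.

Definition atomless d (T : measurableType d) (S : probability T R) : Prop :=
  forall A, measurable A -> (0 < S A)%E ->
    exists B, [/\ measurable B, B `<=` A & (0 < S B < S A)%E].

Definition coupling D (X Y : set (vec D)) (P : probability (vec D) R)
  (pi : probability (vec D * vec D)%type R) : Prop :=
  pi (X `*` Y) = 1%E /\
  forall A, measurable A -> pi (A `*` Y) = P A.

(* T is an admissible T_pi: measurable map X x Z -> Y with
   T(x,.)#S = pi(.|x) for P-a.e. x, where pi(.|x) is the conditional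
   distribution (disintegration kernel) of pi w.r.t. its first marginal P. *)
Definition noise_map D Z (X Y : set (vec D)) (P : probability (vec D) R)
  (pi : probability (vec D * vec D)%type R) (S : probability (vec Z) R)
  (T : vec D * vec Z -> vec D) : Prop :=
  [/\ measurable_fun [set: vec D * vec Z] T,
      (forall x z, X x -> Y (T (x, z))) &
      exists kappa : vec D -> probability (vec D) R,
        [/\ (forall B, measurable B -> measurable_fun [set: vec D] (fun x => kappa x B : \bar R)),
            (forall A B, measurable A -> measurable B ->
               pi (A `*` B) = (\int[P]_(x in A) kappa x B)%E) &
            {ae P, forall x, forall B, measurable B ->
               S ((fun z => T (x, z)) @^-1` B) = kappa x B}]].

(* the class-guided functional F_G (with a fixed admissible choice pi |-> T_pi) *)
Definition FG D Z N (X Y : set (vec D)) (P : probability (vec D) R)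
  (alpha : 'I_N -> R) (Pn Qn : 'I_N -> probability (vec D) R)
  (S : probability (vec Z) R)
  (Tsel : probability (vec D * vec D)%type R -> vec D * vec Z -> vec D)
  (pi : probability (vec D * vec D)%type R) : \bar R :=
  if `[< coupling X Y P pi >] then
    (\sum_(n < N) (alpha n)%:E *
       energy2 (pushforward (Pn n \x S)%E (Tsel pi)) (Qn n))%E
  else +oo%E.

Definition convex_on_Pi D (X Y : set (vec D)) (P : probability (vec D) R)
  (F : probability (vec D * vec D)%type R -> \bar R) : Prop :=
  forall (pi1 pi2 pi : probability (vec D * vec D)%type R) (l : R),
    coupling X Y P pi1 -> coupling X Y P pi2 -> 0 <= l <= 1 ->
    (forall A, measurable A -> pi A = (l%:E * pi1 A + (1 - l)%:E * pi2 A)%E) ->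
    (F pi <= l%:E * F pi1 + (1 - l)%:E * F pi2)%E.

Definition intR d (T : measurableType d) (mu : set T -> \bar R) (A : set T)
  (f : T -> R) : R := fine (\int[mu]_(z in A) (f z)%:E)%E.

(* lower semi-continuity on Pi(P) for the weak topology on P(X x Y), i.e. the
   topology generated by pi |-> \int f dpi, f in C(X x Y) *)
Definition lsc_on_Pi D (X Y : set (vec D)) (P : probability (vec D) R)
  (F : probability (vec D * vec D)%type R -> \bar R) : Prop :=
  forall pi0, coupling X Y P pi0 -> forall t : R, (t%:E < F pi0)%E ->
    exists (k : nat) (fs : 'I_k -> vec D * vec D -> R) (eps : R),
      [/\ 0 < eps,
          (forall i, {within X `*` Y, continuous (fs i)}) &
          forall pi, coupling X Y P pi ->
            (forall i, `|intR pi (X `*` Y) (fs i) - intR pi0 (X `*` Y) (fs i)| < eps) ->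
            (t%:E < F pi)%E].

(* convex conjugate F^*(h) = sup_pi [ \int h dpi - F(pi) ], h in C(X x Y);
   F = +oo outside Pi(P), so the sup may be taken over probability measures *)
Definition conjF D (X Y : set (vec D))
  (F : probability (vec D * vec D)%type R -> \bar R)
  (h : vec D * vec D -> R) : \bar R :=
  ereal_sup (range (fun pi : probability (vec D * vec D)%type R =>
    ((\int[pi]_(z in X `*` Y) (h z)%:E) - F pi)%E)).

Definition sep_star_increasing D (X Y : set (vec D))
  (F : probability (vec D * vec D)%type R -> \bar R) : Prop :=
  forall (u v : vec D -> R) (c : vec D * vec D -> R),
    {within X, continuous u} -> {within Y, continuous v} ->
    {within X `*` Y, continuous c} ->
    (forall x y, X x -> Y y -> u x + v y <= c (x, y)) ->
    (conjF X Y F (fun z => (u z.1 + v z.2)%R) <= conjF X Y F c)%E.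

End defs.

(* Main.v *)
Require Import Defs.
From HB Require Import structures.
From mathcomp Require Import all_boot all_order all_algebra.
From mathcomp Require Import all_classical all_reals all_analysis.
From mathcomp Require Import measurable_realfun.
From mathcomp Require Import ring lra.
Import Order.TTheory GRing.Theory Num.Theory.
Import numFieldNormedType.Exports.
Local Open Scope classical_set_scope.
Local Open Scope ring_scope.

(* The Euclidean norm is conditionally negative definite, i.e. the energy distance
   is nonnegative; hence it is convex in its first argument and dominates its
   linearization at any measure, whose linear part integrates a continuous
   potential.  When alpha_n > 0, P_n has a density r_n with respect to P, and the
   law of T_pi under P_n x S is the second marginal of r_n(x) pi(dx, dy): it is
   affine in pi, which gives convexity.  For lower semi-continuity, the tangent
   minorant reduces to integrals of r_n(x) psi(y) with psi continuous, and r_n is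
   approximated in L^1(P) by continuous functions; this is uniform in pi because
   the first marginal of pi is fixed.  Monotonicity of the conjugate is that of
   the integral.

   Negative definiteness is reduced to finite-rank kernels: on the sphere the
   chordal distance is sqrt 2 * sqrt (1 - <p, q>), and 1 - sqrt (1 - u) is a uniform
   limit of polynomials in u with nonnegative coefficients; a bounded part of R^D
   is almost isometric to a small cap of a large sphere. *)

(** * Finite-rank approximation of the Euclidean distance *)

Section SqrtIteration.
Set Implicit Arguments.
Unset Strict Implicit.
Context {R : realType}.
Implicit Types u s w : R.

(** Each iterate is a polynomial in [u] with nonnegative coefficients, so substituting a positive
    semidefinite kernel for [u] gives a positive semidefinite kernel again. *)
Fixpoint sqrt_iter (n : nat) (u : R) : R :=
  if n is m.+1 then 2^-1 * (u + sqrt_iter m u ^+ 2) else 0.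

(* [1 - s] is the fixed point of [w |-> (u + w^2) / 2], and the error [e]
   satisfies [e' <= e (1 - e / 2)]. *)
Lemma sqrt_iter_bound n u s : 0 <= s <= 1 -> s ^+ 2 = 1 - u ->
  0 <= sqrt_iter n u /\ 0 <= 1 - s - sqrt_iter n u <= 2 / n.+2%:R.
Proof.
move=> s01 su; elim: n => [|n [w0 /andP[e0 e1]]] /=.
  (* The offset in [n.+2] makes the bound equal to 1 at [n = 0] and keeps it at most 1
     afterwards. *)
  by split=> //; rewrite divff//; apply/andP; split; lra.
set w := sqrt_iter n u in w0 e0 e1 *.
have u0 : 0 <= u by nra.
split; first nra.
set e := 1 - s - w in e0 e1.
have -> : 1 - s - 2^-1 * (u + w ^+ 2) = e * (1 - s - e / 2).
  have -> : u = 1 - s ^+ 2 by lra.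
  by rewrite /e; field.
apply/andP; split.
  by apply: mulr_ge0 => //; rewrite /e in e0 *; lra.
have N2 : (0 : R) < n.+2%:R by rewrite ltr0n.
rewrite -[n.+3]addn1 natrD.
set N : R := n.+2%:R in N2 e1 *.
have N2' : 2 <= N by rewrite /N ler_nat.
have e2 : e <= 1 by rewrite /e; lra.
have d0 : 0 <= 2 / N - e by rewrite subr_ge0.
have h1 : e * (1 - s - e / 2) <= e * (1 - e / 2) by nra.
(* The map [e |-> e * (1 - e / 2)] increases for [e <= 1], so [e] may be replaced by its bound
   [2 / N]. *)
have h2 : e * (1 - e / 2) <= 2 / N * (1 - 1 / N).
  have -> : 1 / N = (2 / N) / 2 by field; rewrite gt_eqF.
  have : 2 / N <= 1 by rewrite ler_pdivrMr//; lra.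
  set a := 2 / N in d0 *; nra.
have h3 : 2 / N * (1 - 1 / N) <= 2 / (N + 1).
  rewrite -subr_ge0.
  have -> : 2 / (N + 1) - 2 / N * (1 - 1 / N) = 2 / (N ^+ 2 * (N + 1)).
    by field; rewrite ?andbT; apply/andP; split; lra.
  by apply: divr_ge0 => //; apply: mulr_ge0; nra.
exact: le_trans h1 (le_trans h2 h3).
Qed.

End SqrtIteration.

(** * Positive semidefinite kernels of finite rank *)

Section FiniteRank.
Set Implicit Arguments.
Unset Strict Implicit.
Context {R : realType} {T : Type}.
Variable A : (T -> R) -> Prop.

(** The same features [h i] occur in both variables, which forces positive semidefiniteness. [A] is
    the class of admissible features, later the functions that can be integrated over [Y]. *)
Definition finite_rank (K : T -> T -> R) : Prop :=
  exists (I : finType) (h : I -> T -> R),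
    (forall i, A (h i)) /\ forall x y, K x y = \sum_i h i x * h i y.

Lemma finite_rank0 : finite_rank (fun _ _ => 0).
Proof.
by exists void, (@of_void _); split=> [[]|x y]; rewrite big_pred0// => -[].
Qed.

Lemma finite_rank1 (h : T -> R) : A h -> finite_rank (fun x y => h x * h y).
Proof.
by move=> Ah; exists unit, (fun=> h); split=> // x y; rewrite big_const card_unit/= addr0.
Qed.

Lemma finite_rankD (K L : T -> T -> R) :
  finite_rank K -> finite_rank L -> finite_rank (fun x y => K x y + L x y).
Proof.
move=> [I [h [Ah Kh]]] [J [k [Ak Lk]]].
exists (I + J)%type, (fun i => match i with inl i => h i | inr j => k j end).
by split=> [[]//|x y]; rewrite big_sumType/= Kh Lk.
Qed.

Lemma finite_rank_sum (I : Type) (s : seq I) (K : I -> T -> T -> R) :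
  (forall i, finite_rank (K i)) -> finite_rank (fun x y => \sum_(i <- s) K i x y).
Proof.
move=> fK; elim: s => [|i s IHs].
  rewrite (_ : (fun _ _ => _) = fun _ _ => 0); first exact: finite_rank0.
  by apply/funext => x; apply/funext => y; rewrite big_nil.
rewrite (_ : (fun _ _ => _) = fun x y => K i x y + \sum_(i <- s) K i x y).
  exact: finite_rankD.
by apply/funext => x; apply/funext => y; rewrite big_cons.
Qed.

(** Schur product: the features of the product kernel are the pairwise products. *)
Lemma finite_rankM (K L : T -> T -> R) :
  (forall f g, A f -> A g -> A (fun x => f x * g x)) ->
  finite_rank K -> finite_rank L -> finite_rank (fun x y => K x y * L x y).
Proof.
move=> AM [I [h [Ah Kh]]] [J [k [Ak Lk]]].
exists (I * J)%type, (fun i x => h i.1 x * k i.2 x); split=> [[i j]|x y].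
  exact: AM.
rewrite Kh Lk big_distrlr/= pair_big/=.
by apply: eq_bigr => i _; rewrite mulrACA.
Qed.

(** The factor is split as [sqrt c * sqrt c] between the two variables, which is where its sign
    matters. *)
Lemma finite_rankZ (c : R) (K : T -> T -> R) : 0 <= c ->
  (forall r f, A f -> A (fun x => r * f x)) ->
  finite_rank K -> finite_rank (fun x y => c * K x y).
Proof.
move=> c0 AZ [I [h [Ah Kh]]].
exists I, (fun i x => Num.sqrt c * h i x); split=> [i|x y]; first exact: AZ.
rewrite Kh mulr_sumr; apply: eq_bigr => i _.
by rewrite mulrACA -expr2 sqr_sqrtr.
Qed.

Lemma finite_rank_sqrt_iter n (K : T -> T -> R) :
  (forall r f, A f -> A (fun x => r * f x)) ->
  (forall f g, A f -> A g -> A (fun x => f x * g x)) ->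
  finite_rank K -> finite_rank (fun x y => sqrt_iter n (K x y)).
Proof.
move=> AZ AM fK; elim: n => [|n IHn] /=; first exact: finite_rank0.
apply: finite_rankZ => //.
by apply: finite_rankD => //; apply: finite_rankM.
Qed.

End FiniteRank.

(** * Euclidean geometry and the chordal distance on a large sphere *)

Section EuclideanKernel.
Set Implicit Arguments.
Unset Strict Implicit.
Context {R : realType} {D : nat}.
Implicit Types x y z : 'rV[R]_D.

Definition dot x y : R := \sum_(i < D) x ord0 i * y ord0 i.

Lemma dotxx_ge0 x : 0 <= dot x x.
Proof. by apply: sumr_ge0 => i _; rewrite -expr2 sqr_ge0. Qed.

Lemma norm2E x : norm2 x = Num.sqrt (dot x x).
Proof. by congr Num.sqrt; apply: eq_bigr => i _; rewrite expr2. Qed.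

Lemma norm2_ge0 x : 0 <= norm2 x.
Proof. exact: sqrtr_ge0. Qed.

Lemma sqr_norm2 x : norm2 x ^+ 2 = dot x x.
Proof. by rewrite norm2E sqr_sqrtr// dotxx_ge0. Qed.

Lemma norm2_eq0 x (i : 'I_D) : norm2 x = 0 -> x ord0 i = 0.
Proof.
move=> x0; have /eqP := sqr_norm2 x; rewrite x0 expr0n/= eq_sym psumr_eq0.
  by move=> /allP/(_ i (mem_index_enum _)); rewrite /= mulf_eq0 orbb => /eqP.
by move=> j _; rewrite -expr2 sqr_ge0.
Qed.

Lemma norm2N x : norm2 (- x) = norm2 x.
Proof. by congr Num.sqrt; apply: eq_bigr => i _; rewrite mxE sqrrN. Qed.

Lemma dotxxD x y : dot (x + y) (x + y) = dot x x + 2 * dot x y + dot y y.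
Proof.
rewrite /dot mulr_sumr -!big_split/=; apply: eq_bigr => i _.
by rewrite !mxE; ring.
Qed.

Lemma dotxxB x y : dot (x - y) (x - y) = dot x x - 2 * dot x y + dot y y.
Proof.
rewrite /dot mulr_sumr -sumrN -!big_split/=; apply: eq_bigr => i _.
by rewrite !mxE; ring.
Qed.

Lemma dotZ a b x y : dot (a *: x) (b *: y) = a * b * dot x y.
Proof.
by rewrite /dot mulr_sumr; apply: eq_bigr => i _; rewrite !mxE; ring.
Qed.

(** Cauchy-Schwarz, from expanding the square of [norm2 y *: x - norm2 x *: y]; vanishing norms are
    treated apart since the expansion is divided by their product. *)
Lemma dot_le_norm2 x y : dot x y <= norm2 x * norm2 y.
Proof.
have := dotxx_ge0 (norm2 y *: x - norm2 x *: y).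
rewrite dotxxB !dotZ -!sqr_norm2.
have := norm2_ge0 x; have := norm2_ge0 y.
rewrite le_eqVlt => /predU1P[y0|y0].
  by move=> _ _; rewrite -y0 mulr0 /dot big1// => i _; rewrite (norm2_eq0 i (esym y0)) mulr0.
rewrite le_eqVlt => /predU1P[x0|x0].
  by move=> _; rewrite -x0 mul0r /dot big1// => i _; rewrite (norm2_eq0 i (esym x0)) mul0r.
set a := norm2 x in x0 *; set b := norm2 y in y0 *.
rewrite (_ : _ + _ = (2 * (a * b)) * (a * b - dot x y)); last by ring.
have ab : 0 < 2 * (a * b) by rewrite !mulr_gt0.
by rewrite pmulr_rge0// subr_ge0.
Qed.

Lemma norm2_triangle x y : norm2 (x + y) <= norm2 x + norm2 y.
Proof.
rewrite -(@ler_pXn2r _ 2)// ?nnegrE ?norm2_ge0 ?addr_ge0 ?norm2_ge0//.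
rewrite sqr_norm2 dotxxD -!sqr_norm2.
by have := dot_le_norm2 x y; nra.
Qed.

Lemma norm2_dist x y z : `|norm2 (x - z) - norm2 (y - z)| <= norm2 (x - y).
Proof.
have h1 := norm2_triangle (x - y) (y - z).
have h2 := norm2_triangle (y - x) (x - z).
have yx : norm2 (y - x) = norm2 (x - y) by rewrite -opprB norm2N.
rewrite addrA subrK yx in h2.
rewrite addrA subrK in h1.
by rewrite ler_norml; apply/andP; split; lra.
Qed.


(* The points [x] of a ball of radius [M] are lifted to the sphere of radius
   [r] in dimension [D + 1], [r * sphere_lift r x] being the extra coordinate.
   The chordal distance [r * sqrt (2 * (1 - u))], with [u] the inner product of
   the rescaled lifts, tends to [norm2 (x - y)] as [r] grows. *)
Definition sphere_lift (r : R) x : R := Num.sqrt (1 - dot x x / r ^+ 2).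

Definition sphere_dot (r : R) x y : R :=
  dot x y / r ^+ 2 + sphere_lift r x * sphere_lift r y.

(** By Pythagoras the squared chord is [norm2 (x - y) ^+ 2 + (r * (p - q)) ^+ 2], with [p] and [q]
    the lifts, and the height difference [r * (p - q)] is of order [M ^+ 2 / r]. *)
Lemma chord_approx (M r : R) x y : 0 <= M -> 0 < r -> 2 * M <= r ->
  norm2 x <= M -> norm2 y <= M ->
  exists s : R, [/\ 0 <= s <= 1, s ^+ 2 = 1 - sphere_dot r x y &
    `|norm2 (x - y) - r * Num.sqrt 2 * s| <= M ^+ 2 / r].
Proof.
move=> M0 r0 Mr xM yM.
have nx := norm2_ge0 x; have ny := norm2_ge0 y.
have r2 : 0 < r ^+ 2 by rewrite exprn_gt0.
(* Since [2 * M <= r], the points fill a cap where the lift is at least one half. *)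
have small z : norm2 z <= M -> dot z z / r ^+ 2 <= 4^-1.
  move=> zM; rewrite ler_pdivrMr// -sqr_norm2; have := norm2_ge0 z; nra.
have q2 z : norm2 z <= M ->
    sphere_lift r z ^+ 2 = 1 - dot z z / r ^+ 2.
  by move=> /small zM; rewrite sqr_sqrtr// subr_ge0; lra.
have qh z : norm2 z <= M -> 2^-1 <= sphere_lift r z.
  move=> zM; have := q2 z zM; have := small z zM.
  have : 0 <= sphere_lift r z by exact: sqrtr_ge0.
  nra.
have qx := qh x xM; have qy := qh y yM.
have q2x := q2 x xM; have q2y := q2 y yM.
set p := sphere_lift r x in qx q2x; set q := sphere_lift r y in qy q2y.
have uE : 2 * (1 - sphere_dot r x y) =
    norm2 (x - y) ^+ 2 / r ^+ 2 + (p - q) ^+ 2.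
  rewrite sqr_norm2 dotxxB /sphere_dot -/p -/q.
  rewrite (_ : (p - q) ^+ 2 = p ^+ 2 - 2 * (p * q) + q ^+ 2); last by ring.
  by rewrite q2x q2y; ring.
have u0 : 0 <= 1 - sphere_dot r x y.
  suff : 0 <= 2 * (1 - sphere_dot r x y) by lra.
  by rewrite uE addr_ge0 ?sqr_ge0 ?divr_ge0 ?sqr_ge0.
(* The planar part of [sphere_dot] is at least [- 4^-1], and [p * q] is at least [4^-1]. *)
have u1 : 1 - sphere_dot r x y <= 1.
  suff : 0 <= sphere_dot r x y by lra.
  rewrite /sphere_dot -/p -/q.
  have : - 4^-1 <= dot x y / r ^+ 2.
    rewrite ler_pdivlMr//.
    have := dot_le_norm2 (- x) y; rewrite norm2N.
    have -> : dot (- x) y = - dot x y.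
      by rewrite /dot -sumrN; apply: eq_bigr => i _; rewrite mxE mulNr.
    nra.
  nra.
exists (Num.sqrt (1 - sphere_dot r x y)); split.
- rewrite sqrtr_ge0/= -[leRHS]sqrtr1; exact: ler_wsqrtr.
- by rewrite sqr_sqrtr.
set s := Num.sqrt (1 - _); set t : R := Num.sqrt 2.
have s0 : 0 <= s by exact: sqrtr_ge0.
have t0 : 0 <= t by exact: sqrtr_ge0.
have s2 : s ^+ 2 = 1 - sphere_dot r x y by rewrite sqr_sqrtr.
have t2 : t ^+ 2 = 2 by rewrite sqr_sqrtr.
set a := norm2 (x - y); have a0 : 0 <= a by exact: norm2_ge0.
have rts0 : 0 <= r * t * s by rewrite !mulr_ge0// ltW.
have rts : (r * t * s) ^+ 2 = a ^+ 2 + (r * (p - q)) ^+ 2.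
  rewrite !exprMn t2 s2 -mulrA uE -/a mulrDr mulrCA divff ?mulr1//.
  by rewrite gt_eqF.
(* Factor [r ^+ 2 * (p ^+ 2 - q ^+ 2) = dot y y - dot x x] and use [1 <= p + q]. *)
have rpq : `|r * (p - q)| <= M ^+ 2 / r.
  rewrite normrM gtr0_norm// ler_pdivlMr// mulrC mulrA -expr2.
  have dx := dotxx_ge0 x; have dy := dotxx_ge0 y.
  have xM2 : dot x x <= M ^+ 2 by rewrite -sqr_norm2; nra.
  have yM2 : dot y y <= M ^+ 2 by rewrite -sqr_norm2; nra.
  have H : r ^+ 2 * ((p - q) * (p + q)) = dot y y - dot x x.
    rewrite -subr_sqr q2x q2y; field; exact: lt0r_neq0.
  have pq0 : 1 <= p + q by lra.
  have H' : r ^+ 2 * `|p - q| * (p + q) <= M ^+ 2.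
    have pqE : `|p - q| * (p + q) = `|(p - q) * (p + q)|.
      by rewrite normrM [X in _ = _ * X]ger0_norm//; lra.
    rewrite -mulrA pqE -{1}(gtr0_norm r2) -normrM H.
    by rewrite ler_norml; apply/andP; split; lra.
  apply: le_trans H'; rewrite ler_peMr// mulr_ge0// ltW//.
(* A hypotenuse exceeds one leg by at most the length of the other. *)
apply: le_trans rpq; set b := r * (p - q) in rts *.
have nb : `|b| ^+ 2 = b ^+ 2 by rewrite real_normK// num_real.
have b0 := normr_ge0 b.
rewrite ler_norml; apply/andP; split; nra.
Qed.

(** The distance is close to [C * s], and [1 - s] is close to the polynomial iterate [w], so
    [C - C * w] approximates it. The radius is fixed first, then the degree, each costing
    [e / 2]. *)
Lemma norm2_finite_rank_approx (A : ('rV[R]_D -> R) -> Prop) (M e : R) :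
  (forall r f, A f -> A (fun x => r * f x)) ->
  (forall f g, A f -> A g -> A (fun x => f x * g x)) ->
  (forall i : 'I_D, A (fun x => x ord0 i)) ->
  (forall r, A (sphere_lift r)) ->
  0 <= M -> 0 < e ->
  exists (c : R) (K : 'rV[R]_D -> 'rV[R]_D -> R), finite_rank A K /\
    forall x y, norm2 x <= M -> norm2 y <= M ->
      `|norm2 (x - y) - (c - K x y)| <= e.
Proof.
move=> AZ AM AX Alift M0 e0.
(* The first summand serves [chord_approx], the second makes [M ^+ 2 / r <= e / 2], the last keeps
   [r] positive. *)
pose r := 2 * M + 2 * M ^+ 2 / e + 1.
have M2e : 0 <= 2 * M ^+ 2 / e by apply: divr_ge0 (ltW e0); rewrite mulr_ge0 ?sqr_ge0.
have r0 : 0 < r by rewrite /r; lra.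
have Mr : M ^+ 2 / r <= e / 2.
  rewrite ler_pdivrMr// /r.
  have -> : e / 2 * (2 * M + 2 * M ^+ 2 / e + 1) = e * M + e / 2 + M ^+ 2.
    by field; rewrite gt_eqF.
  have := mulr_ge0 (ltW e0) M0; lra.
pose C := r * Num.sqrt 2; have C0 : 0 <= C by rewrite mulr_ge0 ?sqrtr_ge0 ?ltW.
pose n := `|Num.ceil (4 * C / e)|%N.
have nC : C * (2 / n.+2%:R) <= e / 2.
  rewrite mulrA ler_pdivrMr ?ltr0n//.
  have h : 4 * C / e <= n.+2%:R.
    apply: (le_trans (ceil_ge _)).
    apply: (@le_trans _ _ n%:R); last by rewrite ler_nat; do 2 apply: leqW.
    by rewrite /n natr_absz ler_int ler_norm.
  rewrite ler_pdivrMr// in h; lra.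
exists C, (fun x y => C * sqrt_iter n (sphere_dot r x y)); split.
  apply: finite_rankZ => //; apply: finite_rank_sqrt_iter => //.
  apply: finite_rankD.
    rewrite (_ : (fun _ _ => _) =
      fun x y : 'rV[R]_D => r ^- 2 * \sum_(i < D) x ord0 i * y ord0 i); last first.
      by apply/funext => x; apply/funext => y; rewrite mulrC.
    apply: finite_rankZ => //; first by rewrite invr_ge0 exprn_ge0// ltW.
    by apply: finite_rank_sum => i; exact: finite_rank1 (AX i).
  exact: finite_rank1.
move=> x y xM yM.
have r2M : 2 * M <= r by rewrite /r; lra.
have [s [s01 su]] := chord_approx M0 r0 r2M xM yM; rewrite -/C => ds.
have [_ /andP[w0 w1]] := sqrt_iter_bound n s01 su.
set w := sqrt_iter n _ in w0 w1 *.
rewrite (_ : _ - _ = (norm2 (x - y) - C * s) - C * (1 - s - w)); last by ring.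
apply: (le_trans (ler_normB _ _)).
have : `|C * (1 - s - w)| <= C * (2 / n.+2%:R).
  by rewrite ger0_norm; [exact: ler_wpM2l|exact: mulr_ge0].
move=> h; rewrite [leRHS]splitr.
exact: lerD (le_trans ds Mr) (le_trans h nC).
Qed.

End EuclideanKernel.

(** * Energy distance on a bounded set *)

Section RowVectorMeasurability.
Set Implicit Arguments.
Unset Strict Implicit.
Context {R : realType} {D : nat}.

Lemma measurable_coord (i : 'I_D) :
  measurable_fun [set: 'rV[R]_D] (fun x : 'rV[R]_D => x ord0 i).
Proof.
move=> _ A mA; apply: sub_gen_smallest; rewrite (bigD1 i)//=.
by left; exists A.
Qed.

Lemma measurable_norm2 d (T : measurableType d) (f : T -> 'rV[R]_D) :
  (forall i, measurable_fun [set: T] (fun t => f t ord0 i)) ->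
  measurable_fun [set: T] (fun t => norm2 (f t)).
Proof.
move=> mf; apply: (measurableT_comp (continuous_measurable_fun (@sqrt_continuous R))) => //.
by apply: measurable_sum => i; exact: measurable_funX.
Qed.

Lemma measurable_sphere_lift r : measurable_fun [set: 'rV[R]_D] (sphere_lift r).
Proof.
apply: (measurableT_comp (continuous_measurable_fun (@sqrt_continuous R))) => //.
apply: measurable_funB => //; apply: measurable_funM => //.
by apply: measurable_sum => i; apply: measurable_funM; exact: measurable_coord.
Qed.

Lemma continuous_norm2 : continuous (@norm2 R D).
Proof.
have cs : continuous (fun x : 'rV[R]_D => \sum_(i < D) x ord0 i ^+ 2).
  apply: continuous_big => [|i _ x]; first exact: add_continuous.
  apply: (@continuous_comp _ _ _ (fun x : 'rV[R]_D => x ord0 i) (fun r : R => r ^+ 2)).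
    exact: coord_continuous.
  exact: exprn_continuous.
move=> x; apply: (@continuous_comp _ _ _ _ (@Num.sqrt R)); first exact: cs.
exact: sqrt_continuous.
Qed.

Lemma norm2_0 : norm2 (0 : 'rV[R]_D) = 0.
Proof. by rewrite /norm2 big1 ?sqrtr0// => i _; rewrite mxE expr0n. Qed.

Lemma compact_norm2_bounded (Y : set 'rV[R]_D) : compact Y ->
  exists2 M, 0 <= M & forall y, Y y -> norm2 y <= M.
Proof.
move=> cY.
have : compact (@norm2 R D @` Y).
  apply: continuous_compact => //; apply: continuous_subspaceT.
  exact: continuous_norm2.
move=> /compact_bounded[M [_ HM]]; exists (`|M| + 1); first by rewrite addr_ge0.
move=> y Yy; apply: le_trans (ler_norm _) _.
apply: (HM (`|M| + 1)); first by rewrite ltr_pwDr// ler_norm.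
by exists y.
Qed.

End RowVectorMeasurability.

(** * Potentials and the bilinear form of the distance kernel *)

Section EnergyForm.
Set Implicit Arguments.
Unset Strict Implicit.
Context {R : realType} {D : nat}.
Local Notation vec := 'rV[R]_D.
Variables (Y : set vec) (M : R).
Hypotheses (mY : measurable Y) (M0 : 0 <= M) (YM : forall y, Y y -> norm2 y <= M).
Implicit Types (m : probability vec R) (f g : vec -> R).

(** The feature class for [finite_rank]. Boundedness is asked on [Y] only, so that the coordinate
    functions belong to it. *)
Definition bounded_meas f : Prop :=
  measurable_fun [set: vec] f /\ exists B, forall y, Y y -> `|f y| <= B.

Lemma bounded_measD f g :
  bounded_meas f -> bounded_meas g -> bounded_meas (fun x => f x + g x).
Proof.
move=> [mf [B fB]] [mg [C gC]]; split; first exact: measurable_funD.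
exists (B + C) => y Yy; apply: le_trans (ler_normD _ _) _.
by apply: lerD; [exact: fB|exact: gC].
Qed.

Lemma bounded_measM f g :
  bounded_meas f -> bounded_meas g -> bounded_meas (fun x => f x * g x).
Proof.
move=> [mf [B fB]] [mg [C gC]]; split; first exact: measurable_funM.
exists (B * C) => y Yy; rewrite normrM.
by apply: ler_pM => //; [exact: fB|exact: gC].
Qed.

Lemma bounded_meas_cst r : bounded_meas (fun=> r).
Proof. by split; [exact: measurable_cst|exists `|r|]. Qed.

Lemma bounded_measZ r f : bounded_meas f -> bounded_meas (fun x => r * f x).
Proof. exact: bounded_measM (bounded_meas_cst r). Qed.

Lemma bounded_meas_sum (I : Type) (s : seq I) (F : I -> vec -> R) :
  (forall i, bounded_meas (F i)) -> bounded_meas (fun x => \sum_(i <- s) F i x).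
Proof.
move=> bF; elim: s => [|i s IHs].
  rewrite (_ : (fun _ => _) = fun=> 0); first exact: bounded_meas_cst.
  by apply/funext => x; rewrite big_nil.
rewrite (_ : (fun _ => _) = fun x => F i x + \sum_(i <- s) F i x).
  exact: bounded_measD.
by apply/funext => x; rewrite big_cons.
Qed.

Lemma bounded_meas_coord (i : 'I_D) : bounded_meas (fun x => x ord0 i).
Proof.
split; first exact: measurable_coord.
exists M => y Yy; apply: le_trans (YM Yy).
rewrite -(@ler_pXn2r _ 2)// ?nnegrE ?norm2_ge0// sqr_norm2.
rewrite real_normK ?num_real// /dot (bigD1 i)//= -expr2 lerDl.
by apply: sumr_ge0 => j _; rewrite -expr2 sqr_ge0.
Qed.

Lemma bounded_meas_sphere_lift r : bounded_meas (sphere_lift r).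
Proof.
split; first exact: measurable_sphere_lift.
exists 1 => y Yy; rewrite ger0_norm ?sqrtr_ge0// -[leRHS]sqrtr1.
apply: ler_wsqrtr; rewrite lerBlDr lerDl.
by rewrite divr_ge0 ?dotxx_ge0 ?sqr_ge0.
Qed.

Lemma bounded_meas_dist x : bounded_meas (fun y => norm2 (x - y)).
Proof.
split.
  apply: measurable_norm2 => i.
  rewrite (_ : (fun _ => _) = (fun t : vec => x ord0 i - t ord0 i)).
    by apply: measurable_funB => //; exact: measurable_coord.
  by apply/funext => t; rewrite !mxE.
exists (norm2 x + M) => y Yy; rewrite ger0_norm ?norm2_ge0//.
apply: le_trans (norm2_triangle _ _) _.
by rewrite norm2N lerD2l YM.
Qed.

Lemma bounded_meas_integrable m f : bounded_meas f ->
  m.-integrable Y (EFin \o f).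
Proof.
move=> [mf [B fB]]; apply: measurable_bounded_integrable => //.
- by rewrite (le_lt_trans (probability_le1 _ _))// ltry.
- exact: measurable_funTS.
- exists B; split; first exact: num_real.
  by move=> C BC y Yy; exact: le_trans (fB _ Yy) (ltW BC).
Qed.

Lemma Rintegral_mean_cst m (c : R) : m Y = 1%E -> \int[m]_(x in Y) (fun=> c) x = c.
Proof.
by move=> mY1; rewrite Rintegral_cst// [X in fine X](_ : _ = 1%E)// mulr1.
Qed.

Lemma Rintegral_lincomb (I : Type) (s : seq I) m (c : R) (b : I -> R)
    (F : I -> vec -> R) : m Y = 1%E -> (forall i, bounded_meas (F i)) ->
  \int[m]_(x in Y) (c - \sum_(i <- s) F i x * b i) =
  c - \sum_(i <- s) (\int[m]_(x in Y) F i x) * b i.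
Proof.
move=> mY1 bF.
have bFb i : bounded_meas (fun x => F i x * b i).
  exact: bounded_measM (bounded_meas_cst _).
rewrite RintegralB//; last 2 first.
  exact: bounded_meas_integrable (bounded_meas_cst c).
  exact: bounded_meas_integrable (bounded_meas_sum _ bFb).
rewrite Rintegral_mean_cst//; congr (_ - _).
elim: s => [|i s IHs].
  under eq_Rintegral do rewrite big_nil.
  by rewrite big_nil Rintegral_mean_cst.
under eq_Rintegral do rewrite big_cons.
rewrite RintegralD ?big_cons ?IHs//; last 2 first.
  exact: bounded_meas_integrable.
  exact: bounded_meas_integrable (bounded_meas_sum _ bFb).
by rewrite RintegralZr//; exact: bounded_meas_integrable.
Qed.

Lemma Rintegral_dist_le m f g e : m Y = 1%E ->
  bounded_meas f -> bounded_meas g -> (forall y, Y y -> `|f y - g y| <= e) ->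
  `|\int[m]_(x in Y) f x - \int[m]_(x in Y) g x| <= e.
Proof.
move=> mY1 bf bg fg.
have bfg : bounded_meas (fun x => f x - g x).
  rewrite (_ : (fun _ => _) = (fun x => f x + -1 * g x)).
    by apply: bounded_measD => //; exact: bounded_measZ.
  by apply/funext => x; rewrite mulN1r.
rewrite -RintegralB//; try exact: bounded_meas_integrable.
apply: le_trans (le_normr_Rintegral mY (bounded_meas_integrable _ bfg)) _.
have -> : e = \int[m]_(x in Y) (fun=> e) x.
  by rewrite Rintegral_mean_cst//.
apply: le_Rintegral => //.
- exact/integrable_norm/bounded_meas_integrable.
- exact: bounded_meas_integrable (bounded_meas_cst e).
Qed.

Definition potential m (x : vec) : R := \int[m]_(y in Y) norm2 (x - y).

Lemma potential_ge0 m x : 0 <= potential m x.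
Proof. by apply: Rintegral_ge0 => y _; exact: norm2_ge0. Qed.

Lemma potential_lipschitz m x x' : m Y = 1%E ->
  `|potential m x - potential m x'| <= norm2 (x - x').
Proof.
move=> mY1; apply: Rintegral_dist_le => //; try exact: bounded_meas_dist.
by move=> y _; exact: norm2_dist.
Qed.

Lemma potential_le m x : m Y = 1%E -> Y x -> potential m x <= 2 * M.
Proof.
move=> mY1 Yx; have -> : 2 * M = \int[m]_(y in Y) (fun=> 2 * M) y.
  by rewrite Rintegral_mean_cst//.
apply: le_Rintegral => //; try exact: bounded_meas_integrable (bounded_meas_dist _).
  exact: bounded_meas_integrable (bounded_meas_cst _).
move=> y Yy; apply: le_trans (norm2_triangle _ _) _.
by rewrite norm2N mulr2n mulrDl mul1r lerD// YM.
Qed.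

Lemma continuous_potential m : m Y = 1%E -> continuous (potential m).
Proof.
move=> mY1 x; apply/(@cvgrPdist_le _ _ _ _ (nbhs_filter x)) => e e0.
have c0 : continuous (fun x' : vec => norm2 (x - x')).
  move=> x'; apply: (@continuous_comp _ _ _ (fun x' : vec => x - x') (@norm2 R D)).
    exact: (@cvgB _ _ _ _ (nbhs_filter x') (fun=> x) id x x' (cvg_cst x) cvg_id).
  exact: continuous_norm2.
have /(@cvgrPdist_le _ _ _ _ (nbhs_filter x))/(_ e e0) := c0 x.
rewrite subrr norm2_0; apply: filterS => x'.
rewrite sub0r normrN ger0_norm ?norm2_ge0//.
exact: le_trans (potential_lipschitz _ _ mY1).
Qed.

Lemma measurable_dist :
  measurable_fun [set: vec * vec] (fun z => norm2 (z.1 - z.2)).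
Proof.
apply: measurable_norm2 => i.
rewrite (_ : (fun _ => _) = (fun t : vec * vec => t.1 ord0 i - t.2 ord0 i)).
  by apply: measurable_funB => //;
    apply: (measurableT_comp (measurable_coord i)) => //.
by apply/funext => t; rewrite !mxE.
Qed.

Lemma integral_potential m x : 
  (\int[m]_(y in Y) (norm2 (x - y))%:E = (potential m x)%:E)%E.
Proof.
rewrite fineK//; apply: integrable_fin_num => //.
exact: bounded_meas_integrable (bounded_meas_dist x).
Qed.

Lemma bounded_meas_potential m : m Y = 1%E -> bounded_meas (potential m).
Proof.
move=> mY1; split; last first.
  exists (2 * M) => y Yy; rewrite ger0_norm ?potential_ge0//.
  exact: potential_le.
(* The indicator of [Y] turns the integral over [Y] into one over the whole space, to which Tonelli
   applies. *)
have mF : measurable_fun [set: vec * vec]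
    (fun z => (norm2 (z.1 - z.2) * \1_Y z.2)%:E).
  apply/measurable_EFinP; apply: measurable_funM; first exact: measurable_dist.
  by apply: (measurableT_comp (measurable_indic _)) => //.
have F0 z : (0 <= (norm2 (z.1 - z.2) * \1_Y z.2)%:E)%E.
  by rewrite lee_fin mulr_ge0// norm2_ge0.
apply/measurable_EFinP.
rewrite (_ : _ \o _ = fubini_F m (fun z : vec * vec => (norm2 (z.1 - z.2) * \1_Y z.2)%:E)).
  exact: (@measurable_fun_fubini_tonelli_F _ _ vec vec R m _ mF F0).
apply/funext => x; rewrite /= -integral_potential integral_mkcond /fubini_F.
by apply: eq_integral => y _; rewrite epatch_indic/= EFinM.
Qed.

Definition cross m1 m2 : R := \int[m1]_(x in Y) potential m2 x.

(** Integrating against a probability does not enlarge a uniform error; this is applied first to the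
    outer variable, then to the inner one. *)
Lemma cross_approx (c e : R) (I : finType) (h : I -> vec -> R) m1 m2 :
  m1 Y = 1%E -> m2 Y = 1%E -> (forall i, bounded_meas (h i)) ->
  (forall x y, Y x -> Y y ->
    `|norm2 (x - y) - (c - \sum_i h i x * h i y)| <= e) ->
  `|cross m1 m2 - (c - \sum_i (\int[m1]_(x in Y) h i x) *
                             (\int[m2]_(x in Y) h i x))| <= e.
Proof.
move=> m1Y m2Y bh he.
have bl b : bounded_meas (fun x => c - \sum_i h i x * b i).
  rewrite (_ : (fun _ => _) = (fun x => c + -1 * \sum_i h i x * b i)).
    apply: bounded_measD; first exact: bounded_meas_cst.
    by apply/bounded_measZ/bounded_meas_sum => i;
      apply: bounded_measM => //; exact: bounded_meas_cst.
  by apply/funext => x; rewrite mulN1r.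
rewrite -Rintegral_lincomb//; apply: Rintegral_dist_le => //.
  exact: bounded_meas_potential.
move=> x Yx; under eq_bigr do rewrite mulrC.
rewrite -Rintegral_lincomb//; apply: Rintegral_dist_le => //.
  exact: bounded_meas_dist.
by move=> y Yy; under eq_bigr do rewrite mulrC; exact: he.
Qed.

(** The index type, the constant and the coefficients are common to all pairs of measures, so
    approximations of several values of [cross] can be combined. *)
Lemma cross_approx_ex (e : R) : 0 < e ->
  exists (I : finType) (c : R) (a : probability vec R -> I -> R),
    forall m1 m2, m1 Y = 1%E -> m2 Y = 1%E ->
      `|cross m1 m2 - (c - \sum_i a m1 i * a m2 i)| <= e.
Proof.
move=> e0.
have [c [K [[I [h [bh Kh]]] Ke]]] := norm2_finite_rank_approx bounded_measZ
  bounded_measM bounded_meas_coord bounded_meas_sphere_lift M0 e0.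
exists I, c, (fun m i => \int[m]_(x in Y) h i x) => m1 m2 m1Y m2Y.
apply: cross_approx => // x y Yx Yy.
by rewrite -Kh; apply: Ke; exact: YM.
Qed.

(** The approximating expressions are symmetric in the two measures, and the error is arbitrary. *)
Lemma cross_sym m1 m2 : m1 Y = 1%E -> m2 Y = 1%E -> cross m1 m2 = cross m2 m1.
Proof.
move=> m1Y m2Y; apply/eqP; rewrite -subr_eq0 -normr_le0.
apply/ler_addgt0Pr => e e0; rewrite add0r.
have e2 : 0 < e / 2 by rewrite divr_gt0.
have [I [c [a ha]]] := cross_approx_ex e2.
have h12 := ha _ _ m1Y m2Y; have := ha _ _ m2Y m1Y.
under eq_bigr do rewrite mulrC.
set S := c - _ in h12 *; rewrite distrC => h21.
have -> : cross m1 m2 - cross m2 m1 = (cross m1 m2 - S) + (S - cross m2 m1) by ring.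
by apply: le_trans (ler_normD _ _) _; rewrite [leRHS]splitr lerD.
Qed.

(* The kernel [- norm2 (x - y)] is conditionally positive definite: with the
   approximation [c - \sum_i a i * a i], the left-hand side becomes
   [\sum_i (a m1 i - a m2 i) ^+ 2]. *)
Lemma cross_energy_ge0 m1 m2 : m1 Y = 1%E -> m2 Y = 1%E ->
  0 <= 2 * cross m1 m2 - cross m1 m1 - cross m2 m2.
Proof.
move=> m1Y m2Y; apply/ler_addgt0Pr => e e0.
have e4 : 0 < e / 4 by rewrite divr_gt0.
have [I [c [a ha]]] := cross_approx_ex e4.
have := ha _ _ m1Y m2Y; have := ha _ _ m1Y m1Y; have := ha _ _ m2Y m2Y.
rewrite !ler_norml => /andP[l1 u1] /andP[l2 u2] /andP[l3 u3].
have : 0 <= \sum_i (a m1 i - a m2 i) ^+ 2 by apply: sumr_ge0 => i _; exact: sqr_ge0.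
have -> : \sum_i (a m1 i - a m2 i) ^+ 2 = \sum_i a m1 i * a m1 i
    - 2 * \sum_i a m1 i * a m2 i + \sum_i a m2 i * a m2 i.
  rewrite mulr_sumr -sumrN -!big_split/=; apply: eq_bigr => i _; ring.
lra.
Qed.

(** The complement of [Y] is null for both measures, so the integrals over the whole space in
    [energy2] reduce to finite ones over [Y]. *)
Lemma energy2_cross m1 m2 : m1 Y = 1%E -> m2 Y = 1%E ->
  energy2 m1 m2 =
  (cross m1 m2 - 2^-1 * cross m1 m1 - 2^-1 * cross m2 m2)%:E.
Proof.
have mYC : measurable (~` Y) by exact: measurableC.
have null m : m Y = 1%E -> m (~` Y) = 0%E.
  by move=> mY1; rewrite probability_setC// mY1 subee.
have toY m (f : vec -> \bar R) : m Y = 1%E -> measurable_fun setT f ->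
    (forall x, 0 <= f x)%E -> (\int[m]_x f x = \int[m]_(x in Y) f x)%E.
  move=> mY1 mf f0; rewrite (ge0_negligible_integral mYC)//; last exact: null.
  by rewrite setTD setCK.
have inner m x : m Y = 1%E -> (\int[m]_y (norm2 (x - y))%:E = (potential m x)%:E)%E.
  move=> mY1; rewrite toY//; first exact: integral_potential.
    by apply/measurable_EFinP; have [] := bounded_meas_dist x.
  by move=> y; rewrite lee_fin norm2_ge0.
have outer m m' : m Y = 1%E -> m' Y = 1%E ->
    (\int[m]_x \int[m']_y (norm2 (x - y))%:E = (cross m m')%:E)%E.
  move=> mY1 m'Y1; under eq_integral do rewrite inner//.
  have [mp _] := bounded_meas_potential m'Y1.
  rewrite toY//.
  - rewrite fineK//; apply: integrable_fin_num => //.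
    exact: bounded_meas_integrable (bounded_meas_potential m'Y1).
  - exact/measurable_EFinP.
  - by move=> x; rewrite lee_fin potential_ge0.
by move=> m1Y m2Y; rewrite /energy2 !outer//.
Qed.

End EnergyForm.

(** * Integration and approximation in L^1 *)

Section WeightedTransfer.
Set Implicit Arguments.
Unset Strict Implicit.
Local Open Scope ereal_scope.
Context {R : realType}.

Import HBNNSimple.

(** Monotone convergence along simple functions. The limit involves [mu], [g] and [w] only through
    weighted integrals of indicators, so agreement on indicators will imply agreement on all
    nonnegative [f]. *)
Lemma weighted_integral_lim d1 d (T1 : measurableType d1) (T : measurableType d)
    (mu : {measure set T1 -> \bar R}) (g : T1 -> T) (w : T1 -> \bar R)
    (f : T -> \bar R) (mf : measurable_fun [set: T] f) :
  measurable_fun [set: T1] g -> measurable_fun [set: T1] w ->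
  (forall x, 0 <= w x) -> (forall x, w x \is a fin_num) -> (forall y, 0 <= f y) ->
  let h := nnsfun_approx measurableT mf in
  \int[mu]_x (w x * f (g x)) =
  limn (fun n => \sum_(y \in range (h n))
    y%:E * \int[mu]_x (w x * (\1_(h n @^-1` [set y]) (g x))%:E)).
Proof.
move=> mg mw w0 wfin f0 h.
have mh n : measurable_fun [set: T1] (fun x => (h n (g x))%:E).
  by apply/measurable_EFinP; exact: (measurableT_comp (@measurable_funPT _ _ _ _ (h n))).
transitivity (limn (fun n => \int[mu]_x (w x * (h n (g x))%:E))).
  rewrite -monotone_convergence//.
  - apply: eq_integral => x _; apply/esym/cvg_lim => //.
    by apply: cvgeZl => //; apply: cvg_nnsfun_approx.
  - by move=> n; exact: emeasurable_funM.
  - by move=> n x _; rewrite mule_ge0// lee_fin.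
  - move=> x _ a b ab; rewrite lee_wpmul2l// lee_fin.
    exact/lefP/nd_nnsfun_approx.
congr (limn _); apply/funext => n.
transitivity (\int[mu]_x (\sum_(y \in range (h n))
    (y%:E * (w x * (\1_(h n @^-1` [set y]) (g x))%:E)))).
  apply: eq_integral => x _; rewrite fimfunE -fsumEFin// ge0_mule_fsumr; last first.
    by move=> y; rewrite EFinM nnfun_muleindic_ge0.
  by apply: eq_fsbigr => y _; rewrite EFinM muleCA.
have mi y : measurable_fun [set: T1]
    (fun x => w x * (\1_(h n @^-1` [set y]) (g x))%:E).
  apply: emeasurable_funM => //; apply/measurable_EFinP.
  exact: (measurableT_comp (measurable_indic _)).
rewrite ge0_integral_fsum//; last 2 first.
- by move=> y; exact: emeasurable_funM.
- by move=> y x _; rewrite muleCA mule_ge0// nnfun_muleindic_ge0.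
apply: eq_fsbigr => y; rewrite inE => -[t _ <-].
rewrite ge0_integralZl//.
- by move=> x _; rewrite mule_ge0// lee_fin.
- by rewrite lee_fin.
Qed.

Lemma weighted_integral_eq d1 d2 d (T1 : measurableType d1)
    (T2 : measurableType d2) (T : measurableType d)
    (mu1 : {measure set T1 -> \bar R}) (mu2 : {measure set T2 -> \bar R})
    (g1 : T1 -> T) (g2 : T2 -> T) (w1 : T1 -> \bar R) (w2 : T2 -> \bar R) :
  measurable_fun [set: T1] g1 -> measurable_fun [set: T2] g2 ->
  measurable_fun [set: T1] w1 -> measurable_fun [set: T2] w2 ->
  (forall x, 0 <= w1 x) -> (forall x, w1 x \is a fin_num) ->
  (forall x, 0 <= w2 x) -> (forall x, w2 x \is a fin_num) ->
  (forall A, measurable A -> \int[mu1]_x (w1 x * (\1_A (g1 x))%:E) =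
                             \int[mu2]_x (w2 x * (\1_A (g2 x))%:E)) ->
  forall f : T -> \bar R, measurable_fun [set: T] f -> (forall y, 0 <= f y) ->
  \int[mu1]_x (w1 x * f (g1 x)) = \int[mu2]_x (w2 x * f (g2 x)).
Proof.
move=> mg1 mg2 mw1 mw2 w10 w1f w20 w2f H f mf f0.
rewrite (weighted_integral_lim mu1 mf)// (weighted_integral_lim mu2 mf)//.
congr (limn _); apply/funext => n; apply: eq_fsbigr => y _.
by rewrite H.
Qed.

Lemma integral_density d1 d (T1 : measurableType d1) (T : measurableType d)
    (m : {measure set T -> \bar R}) (mu : {measure set T1 -> \bar R})
    (g : T1 -> T) (w : T1 -> \bar R) :
  measurable_fun [set: T1] g -> measurable_fun [set: T1] w ->
  (forall x, 0 <= w x) -> (forall x, w x \is a fin_num) ->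
  (forall A, measurable A -> m A = \int[mu]_x (w x * (\1_A (g x))%:E)) ->
  forall f : T -> \bar R, measurable_fun [set: T] f -> (forall y, 0 <= f y) ->
  \int[m]_y f y = \int[mu]_x (w x * f (g x)).
Proof.
move=> mg mw w0 wf H f mf f0.
rewrite -(@weighted_integral_eq _ _ _ T T1 T m mu id g (cst 1) w)//.
  by apply: eq_integral => x _; rewrite mul1e.
move=> A mA; rewrite -H//; under eq_integral do rewrite mul1e.
by rewrite integral_indic// setIT.
Qed.

Lemma integral_mixture d (T : measurableType d) (m m1 m2 : {measure set T -> \bar R})
    (l : R) (f : T -> \bar R) : (0 <= l <= 1)%R ->
  (forall A, measurable A -> m A = l%:E * m1 A + (1 - l)%:E * m2 A) ->
  measurable_fun [set: T] f -> (forall x, 0 <= f x) ->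
  \int[m]_x f x = l%:E * \int[m1]_x f x + (1 - l)%:E * \int[m2]_x f x.
Proof.
move=> /andP[l0 l1] mE mf f0.
have l1' : (0 <= 1 - l)%R by rewrite subr_ge0.
pose a := NngNum l0; pose b := NngNum l1'.
rewrite (@eq_measure_integral _ _ _ _ (measure_add (mscale a m1) (mscale b m2))).
  by rewrite ge0_integral_measure_add// !ge0_integral_mscale.
by move=> A mA _; rewrite mE//; apply/esym; exact: (measure_addE (mscale a m1) (mscale b m2)).
Qed.

(** The integral of a nonnegative function is a supremum over the simple functions below it, hence
    monotone for arbitrary functions; the signed case compares positive and negative parts. *)
Lemma le_integral_pointwise d (T : measurableType d)
    (mu : {measure set T -> \bar R}) (A : set T) (f g : T -> \bar R) :
  (forall x, A x -> f x <= g x) -> \int[mu]_(x in A) f x <= \int[mu]_(x in A) g x.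
Proof.
move=> fg.
have le0 (h k : T -> \bar R) : (forall x, 0 <= h x) -> (forall x, h x <= k x) ->
    \int[mu]_x h x <= \int[mu]_x k x.
  move=> h0 hk; have k0 x : 0 <= k x := le_trans (h0 x) (hk x).
  rewrite !ge0_integralE//; apply: ereal_sup_le => _ [s sh <-].
  exists s => // x; apply: le_trans (sh x) _.
  by rewrite !patch_setT.
rewrite [leLHS]integral_mkcond [leRHS]integral_mkcond.
have fgA x : (f \_ A) x <= (g \_ A) x.
  by rewrite !patchE; case: ifPn => // /set_mem; exact: fg.
rewrite [leLHS]integralE [leRHS]integralE; apply: leeB.
- by apply: le0 => [x|x]; [exact: funepos_ge0|rewrite !funeposE ge_max !le_max fgA lexx/= ?orbT].
- apply: le0 => [x|x]; first exact: funeneg_ge0.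
  by rewrite !funenegE ge_max !le_max leeN2 fgA lexx/= ?orbT.
Qed.

End WeightedTransfer.

(** * Open and compact sets belong to the coordinate sigma-algebra *)

Section CompactMeasurable.
Set Implicit Arguments.
Unset Strict Implicit.
Context {R : realType} {D : nat}.

(** An open set is the union of the rational boxes it contains, and these are countably many. *)
Lemma open_measurable_rV (U : set 'rV[R]_D) : open U -> measurable U.
Proof.
move=> oU.
pose box (c : 'rV[rat]_D * nat) : set 'rV[R]_D :=
  \bigcap_(i in [set: 'I_D]) [set x | `|x ord0 i - ratr (c.1 ord0 i)| < c.2.+1%:R^-1].
have mbox c : measurable (box c).
  apply: fin_bigcap_measurable => // i _.
  rewrite (_ : (fun x : 'rV[R]_D => _) = (fun x : 'rV[R]_D => x ord0 i) @^-1`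
      ball (ratr (c.1 ord0 i) : R) c.2.+1%:R^-1); last first.
    by apply/seteqP; split=> x /=; rewrite -ball_normE /ball_/= distrC.
  rewrite -[X in measurable X]setTI.
  exact: (measurable_coord i measurableT (measurable_ball _ _)).
pose V c := if `[< box c `<=` U >] then box c else set0.
rewrite (_ : U = \bigcup_c V c).
  apply: countable_bigcupT_measurable => [|c]; first exact: countableP.
  by rewrite /V; case: ifP.
apply/seteqP; split=> [x Ux|x [c _]]; last first.
  by rewrite /V; case: asboolP => // + Vx; apply.
have /nbhs_ballP[e /= e0 xeU] := open_nbhs_nbhs (conj oU Ux).
(* Half of [e]: both [x] and any other point of the box are within the box radius of its centre. *)
have e2 : 0 < e / 2 by rewrite divr_gt0.
have [n _ nP] := near_infty_natSinv_lt (PosNum e2).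
have ne : n.+1%:R^-1 < e / 2 by apply: nP => /=.
have n0 : 0 < n.+1%:R^-1 :> R by rewrite invr_gt0.
have /choice[q qP] : forall i : 'I_D, exists q : rat,
    `|x ord0 i - ratr q| < n.+1%:R^-1.
  move=> i.
  have lr : x ord0 i - n.+1%:R^-1 < x ord0 i + n.+1%:R^-1.
    by rewrite ltrBlDr -addrA ltrDl addr_gt0.
  have [q] := rat_in_itvoo lr; rewrite/= in_itv/= => /andP[q1 q2]; exists q.
  by rewrite ltr_norml; apply/andP; split; [rewrite ltrBrDl ltrBlDr|rewrite ltrBlDl -ltrBlDr].
exists (\row_i q i, n) => //; rewrite /V.
have xbox : box (\row_i q i, n) x by move=> i _ /=; rewrite mxE.
case: asboolP => // -[] y ybox; apply: xeU; split=> // i j /=.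
have -> : i = ord0 by apply/val_inj; case: i => -[].
rewrite -ball_normE /ball_/=.
have := ybox j I; have := qP j; rewrite /= mxE => h1 h2.
rewrite (_ : x ord0 j - y ord0 j =
  (x ord0 j - ratr (q j)) - (y ord0 j - ratr (q j))); last by ring.
apply: le_lt_trans (ler_normB _ _) _; rewrite [ltRHS]splitr.
by apply: ltrD; [exact: lt_trans h1 ne|exact: lt_trans h2 ne].
Qed.

Lemma compact_measurable_rV (U : set 'rV[R]_D) : compact U -> measurable U.
Proof.
move=> cU.
have cl : closed U by apply: compact_closed cU; exact: norm_hausdorff.
by have := measurableC (open_measurable_rV (closed_openC cl)); rewrite setCK.
Qed.

End CompactMeasurable.

(** * Density of bounded continuous functions in [L^1(P)] *)

Section L1Density.
Set Implicit Arguments.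
Unset Strict Implicit.
Context {R : realType} {D : nat}.
Local Notation vec := 'rV[R]_D.
Variable P : probability vec R.
Implicit Types (f g : vec -> R) (A B : set vec).

Definition L1_approx f : Prop := forall e : R, 0 < e -> exists g : vec -> R,
  [/\ continuous g, measurable_fun [set: vec] g, (exists C, forall x, `|g x| <= C) &
      (\int[P]_x (`|f x - g x|)%:E <= e%:E)%E].

Let mL1 f g : measurable_fun [set: vec] f -> measurable_fun [set: vec] g ->
  measurable_fun [set: vec] (fun x => (`|f x - g x|)%:E).
Proof.
by move=> mf mg; apply/measurable_EFinP; apply: measurableT_comp => //; exact: measurable_funB.
Qed.

Lemma L1_dist_le f g f1 g1 f2 g2 e1 e2 :
  measurable_fun [set: vec] f -> measurable_fun [set: vec] g ->
  measurable_fun [set: vec] f1 -> measurable_fun [set: vec] g1 ->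
  measurable_fun [set: vec] f2 -> measurable_fun [set: vec] g2 ->
  (forall x, `|f x - g x| <= `|f1 x - g1 x| + `|f2 x - g2 x|) ->
  (\int[P]_x (`|f1 x - g1 x|)%:E <= e1%:E)%E ->
  (\int[P]_x (`|f2 x - g2 x|)%:E <= e2%:E)%E ->
  (\int[P]_x (`|f x - g x|)%:E <= (e1 + e2)%:E)%E.
Proof.
move=> mf mg mf1 mg1 mf2 mg2 H h1 h2; rewrite EFinD.
apply: le_trans (leeD h1 h2).
rewrite -ge0_integralD//; try exact: mL1.
by apply: le_integral_pointwise => x _; rewrite -EFinD lee_fin.
Qed.

Lemma L1_approx_continuous g C : continuous g -> measurable_fun [set: vec] g ->
  (forall x, `|g x| <= C) -> L1_approx g.
Proof.
move=> cg mg gC e e0; exists g; split => //; first by exists C.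
under eq_integral do rewrite subrr normr0.
by rewrite integral0 lee_fin ltW.
Qed.

Lemma L1_approx_cst c : L1_approx (fun=> c).
Proof.
apply: (@L1_approx_continuous _ `|c|) => // x; exact: cst_continuous.
Qed.

Lemma L1_approx_lim f : measurable_fun [set: vec] f ->
  (forall e : R, 0 < e -> exists g, [/\ L1_approx g, measurable_fun [set: vec] g &
    (\int[P]_x (`|f x - g x|)%:E <= e%:E)%E]) -> L1_approx f.
Proof.
move=> mf H e e0; have e2 : 0 < e / 2 by rewrite divr_gt0.
have [g [ag mg fg]] := H _ e2; have [h [ch mh Ch gh]] := ag _ e2.
exists h; split => //; rewrite [e]splitr.
apply: (L1_dist_le (f1 := f) (g1 := g) (f2 := g) (g2 := h)) => // x.
by apply: le_trans (ler_normD _ _); rewrite addrA subrK.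
Qed.

(** An operation that is 1-Lipschitz for the sum of distances preserves approximability: errors add
    up, and the value at the origin controls the bound. It serves addition and maximum. *)
Lemma L1_approx2 (op : R -> R -> R) f1 f2 :
  (forall a b c d, `|op a b - op c d| <= `|a - c| + `|b - d|) ->
  (forall g1 g2, continuous g1 -> continuous g2 ->
    continuous (fun x : vec => op (g1 x) (g2 x))) ->
  (forall g1 g2, measurable_fun [set: vec] g1 -> measurable_fun [set: vec] g2 ->
    measurable_fun [set: vec] (fun x => op (g1 x) (g2 x))) ->
  measurable_fun [set: vec] f1 -> measurable_fun [set: vec] f2 ->
  L1_approx f1 -> L1_approx f2 -> L1_approx (fun x => op (f1 x) (f2 x)).
Proof.
move=> opL opc opm mf1 mf2 a1 a2 e e0.
have e2 : 0 < e / 2 by rewrite divr_gt0.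
have [g1 [cg1 mg1 [C1 gC1] fg1]] := a1 _ e2.
have [g2 [cg2 mg2 [C2 gC2] fg2]] := a2 _ e2.
exists (fun x => op (g1 x) (g2 x)); split; [exact: opc|exact: opm| |].
  exists (C1 + C2 + `|op 0 0|) => x.
  rewrite -[X in `|X|](subrK (op 0 0)).
  apply: le_trans (ler_normD _ _) _; rewrite lerD2r.
  by apply: le_trans (opL _ _ _ _) _; rewrite !subr0 lerD.
rewrite [e]splitr; apply: (L1_dist_le (f1 := f1) (g1 := g1) (f2 := f2) (g2 := g2)) => //;
  exact: opm.
Qed.

Lemma L1_approxD f1 f2 :
  measurable_fun [set: vec] f1 -> measurable_fun [set: vec] f2 ->
  L1_approx f1 -> L1_approx f2 -> L1_approx (fun x => f1 x + f2 x).
Proof.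
apply: (L1_approx2 (op := fun a b => a + b)).
- move=> a b c d; rewrite (_ : a + b - (c + d) = (a - c) + (b - d)); last by ring.
  exact: ler_normD.
- by move=> g1 g2 c1 c2 x; exact: (continuousD (c1 x) (c2 x)).
- by move=> g1 g2; exact: measurable_funD.
Qed.

Lemma L1_approx_max f1 f2 :
  measurable_fun [set: vec] f1 -> measurable_fun [set: vec] f2 ->
  L1_approx f1 -> L1_approx f2 -> L1_approx (fun x => Num.max (f1 x) (f2 x)).
Proof.
apply: (L1_approx2 (op := fun a b => Num.max a b)).
- move=> a b c d.
  have [ac1 ac2] := (ler_norm (a - c), ler_norm (c - a)); rewrite distrC in ac2.
  have [bd1 bd2] := (ler_norm (b - d), ler_norm (d - b)); rewrite distrC in bd2.
  have := normr_ge0 (a - c); have := normr_ge0 (b - d).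
  by move=> ? ?; rewrite ler_norml /Num.max;
    case: ltP => ?; case: ltP => ?; apply/andP; split; lra.
- move=> g1 g2 c1 c2 x; exact: (continuous_max (c1 x) (c2 x)).
- by move=> g1 g2; exact: measurable_maxr.
Qed.

Lemma L1_approxZ r f : measurable_fun [set: vec] f -> L1_approx f ->
  L1_approx (fun x => r * f x).
Proof.
move=> mf af e e0; have r0 : 0 < `|r| + 1 by rewrite ltr_pwDr.
have er : 0 < e / (`|r| + 1) by rewrite divr_gt0.
have [g [cg mg [C gC] fg]] := af _ er.
exists (fun x => r * g x); split.
- by move=> x; exact: (@continuousM _ _ (fun=> r) g x (@cst_continuous _ _ r x) (cg x)).
- exact: measurable_funM.
- by exists (`|r| * C) => x; rewrite normrM ler_wpM2l.
have -> : (e%:E = (`|r| + 1)%:E * (e / (`|r| + 1))%:E)%E.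
  by rewrite -EFinM mulrC divfK// gt_eqF.
apply: (@le_trans _ _ ((`|r| + 1)%:E * \int[P]_x (`|f x - g x|)%:E)%E); last first.
  by rewrite lee_wpmul2l// lee_fin ltW.
rewrite -ge0_integralZl//; try exact: mL1.
apply: le_integral_pointwise => x _; rewrite -EFinM lee_fin -mulrBr normrM.
by rewrite ler_wpM2r// lerDl.
Qed.

Let measurable_indicR A : measurable A -> measurable_fun [set: vec] (\1_A : vec -> R).
Proof. by move=> mA; exact: measurable_indic. Qed.

Lemma L1_approx_setC A : measurable A ->
  L1_approx \1_A -> L1_approx \1_(~` A).
Proof.
move=> mA aA; rewrite (_ : \1_(~` A) = fun x => 1 + -1 * \1_A x :> R).
  apply: L1_approxD => //.
  - by apply: measurable_funM => //; exact: measurable_indicR.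
  - exact: L1_approx_cst.
  - by apply: L1_approxZ => //; exact: measurable_indicR.
apply/funext => x; rewrite !indicE in_setC.
by case: (x \in A) => /=; ring.
Qed.

Lemma L1_approx_setU A B : measurable A -> measurable B ->
  L1_approx \1_A -> L1_approx \1_B -> L1_approx \1_(A `|` B).
Proof.
move=> mA mB aA aB.
rewrite (_ : \1_(A `|` B) = fun x => Num.max (\1_A x) (\1_B x) :> R).
  by apply: L1_approx_max => //; exact: measurable_indicR.
apply/funext => x; rewrite !indicE in_setU.
case: (x \in A); case: (x \in B) => /=; apply/esym;
  [exact: maxxx|apply/max_idPl|apply/max_idPr|exact: maxxx]; exact: ler01.
Qed.

Lemma integral_indic_sub A B : measurable A -> measurable B -> A `<=` B ->
  (\int[P]_x (`|\1_B x - \1_A x : R|)%:E = P (B `\` A))%E.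
Proof.
move=> mA mB AB.
transitivity (\int[P]_x (\1_(B `\` A) x)%:E)%E; last first.
  by rewrite integral_indic ?setIT//; exact: measurableD.
apply: eq_integral => x _; rewrite !indicE in_setD.
have : x \in A -> x \in B by rewrite !inE; exact: AB.
case: (x \in A); case: (x \in B) => //=; rewrite ?subrr ?normr0 ?subr0 ?normr1//.
by move=> /(_ isT).
Qed.

(** Continuity from below of [P]. *)
Lemma L1_indic_exhaust (U : nat -> set vec) (e : R) :
  (forall n, measurable (U n)) -> {homo U : n m / (n <= m)%N >-> (n <= m)%O} ->
  0 < e -> exists n,
    (\int[P]_x (`|\1_(\bigcup_n U n) x - \1_(U n) x : R|)%:E <= e%:E)%E.
Proof.
move=> mU ndU e0; pose V := \bigcup_n U n.
have mV : measurable V by exact: bigcupT_measurable.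
have cU : (P \o U) n @[n --> \oo] --> P V by exact: nondecreasing_cvg_mu.
have [n Pn] : exists n, (P V - e%:E < P (U n))%E.
  apply: contrapT => /forallNP H.
  have : (P V <= P V - e%:E)%E.
    rewrite -{1}(cvg_lim _ cU)//; apply: lime_le; first by apply/cvg_ex; exists (P V).
    by apply: nearW => n; rewrite leNgt; apply/negP/H.
  by rewrite leNgt lteBlDr ?fin_num_measure// lteDl ?fin_num_measure// lte_fin e0.
exists n; have sub : U n `<=` V by exact: bigcup_sup.
rewrite integral_indic_sub// measureD//; last by rewrite ltey_eq fin_num_measure.
rewrite setIidr// leeBlDr ?fin_num_measure// addeC -leeBlDr//.
exact: ltW.
Qed.

(** Finite unions are handled by maxima, then exhaust the countable union. *)
Lemma L1_approx_bigcup (F : nat -> set vec) : (forall n, measurable (F n)) ->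
  (forall n, L1_approx \1_(F n)) -> L1_approx \1_(\bigcup_n F n).
Proof.
move=> mF aF; pose U n := \big[setU/set0]_(i < n) F i.
have mU n : measurable (U n) by exact: bigsetU_measurable.
have aU n : L1_approx \1_(U n).
  elim: n => [|n IHn].
    by rewrite /U big_ord0 indic0; exact: L1_approx_cst.
  by rewrite /U big_ord_recr/=; exact: (L1_approx_setU (mU n) (mF n) IHn (aF n)).
have UF : \bigcup_n F n = \bigcup_n U n.+1 by rewrite bigcup_bigsetU_bigcup.
rewrite UF; apply: L1_approx_lim => [|e e0].
  by apply: measurable_indicR; apply: bigcupT_measurable => n; exact: mU.
have [|n Un] := @L1_indic_exhaust (fun n => U n.+1) e (fun n => mU n.+1) _ e0.
  by move=> m n mn; apply/subsetPset; exact: subset_bigsetU.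
by exists \1_(U n.+1); split; [exact: aU|exact: measurable_indicR|].
Qed.

Lemma measurable_ray (i : 'I_D) (a : R) : measurable [set x : vec | a < x ord0 i].
Proof.
rewrite (_ : [set _ | _] = (fun x : vec => x ord0 i) @^-1` `]a, +oo[); last first.
  by apply/seteqP; split=> x /=; rewrite in_itv/= andbT.
rewrite -[X in measurable X]setTI; exact: (measurable_coord i measurableT).
Qed.

Lemma L1_approx_ray (i : 'I_D) (a : R) :
  L1_approx \1_[set x : vec | a < x ord0 i].
Proof.
pose ray b := [set x : vec | b < x ord0 i].
have mray b : measurable (ray b) by exact: measurable_ray.
pose U n := ray (a + n.+1%:R^-1).
have UE : [set x : vec | a < x ord0 i] = \bigcup_n U n.
  apply/seteqP; split=> [x ax|x [n _]] /=; last first.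
    by apply: lt_trans; rewrite ltrDl invr_gt0.
  have xa : 0 < x ord0 i - a by rewrite subr_gt0.
  have [n _ nP] := near_infty_natSinv_lt (PosNum xa).
  by exists n => //; rewrite /U /ray/= -ltrBrDl; exact: (nP n (leqnn n)).
apply: L1_approx_lim => [|e e0]; first exact: measurable_indicR (mray a).
have [|n Un] := @L1_indic_exhaust U e (fun=> mray _) _ e0.
  move=> m n mn; apply/subsetPset => x; apply: le_lt_trans.
  by rewrite lerD2l lef_pV2 ?posrE// ler_nat.
(* A ramp from 0 at [a] to 1 at [a + n.+1%:R^-1]. It lies between the indicators of [U n] and of the
   half-space, so it is at least as close to the latter as the former is. *)
pose g (x : vec) : R := Num.min 1 (Num.max 0 (n.+1%:R * (x ord0 i - a))).
have g01 x : 0 <= g x <= 1.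
  by rewrite /g ge_min lexx/= andbT le_min ler01/= le_max lexx.
have cg : continuous g.
  move=> x; have cx : {for x, continuous (fun x : vec => n.+1%:R * (x ord0 i - a))}.
    apply: (@continuousM _ _ (fun=> n.+1%:R) (fun x : vec => x ord0 i - a)).
      exact: cst_continuous.
    apply: (@continuousB _ _ _ (fun x : vec => x ord0 i) (fun=> a)).
      exact: coord_continuous.
    exact: cst_continuous.
  apply: (@continuous_min _ _ (fun=> 1) (fun x : vec => Num.max 0 _)).
    exact: cst_continuous.
  apply: (@continuous_max _ _ (fun=> 0) (fun x : vec => _)) => //.
  exact: cst_continuous.
have mg : measurable_fun [set: vec] g.
  apply: measurable_minr => //; apply: measurable_maxr => //.
  apply: measurable_funM => //; apply: measurable_funB => //.
  exact: measurable_coord.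
exists g; split => //.
  apply: (@L1_approx_continuous _ 1) => // x; have /andP[g0 g1] := g01 x.
  by rewrite ger0_norm.
apply: le_trans Un; apply: le_integral_pointwise => x _.
rewrite lee_fin -UE !indicE.
have /andP[g0 g1] := g01 x.
have [ax|ax] := boolP (x \in _).
  have [xn|xn] := boolP (x \in U n); last by rewrite subr0 normr1 ger0_norm ?subr_ge0// gerBl.
  suff -> : g x = 1 by rewrite subrr normr0.
  apply/min_idPl; rewrite le_max; apply/orP; right.
  move/set_mem : xn; rewrite /U /ray/= -ltrBrDl => /ltW.
  by rewrite -(@ler_pM2l _ n.+1%:R)// divff// gt_eqF.
suff -> : g x = 0 by rewrite subrr normr0.
rewrite /g (_ : Num.max _ _ = 0); first by apply/min_idPr; exact: ler01.
apply/max_idPl; rewrite pmulr_rle0// subr_le0 leNgt.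
by apply: contra ax => ax; rewrite inE.
Qed.

(** The sets with approximable indicator form a sigma-algebra containing the half-spaces, which
    generate. *)
Lemma L1_approx_indic A : measurable A -> L1_approx \1_A.
Proof.
pose G := [set A : set vec | measurable A /\ L1_approx \1_A].
have G0 : G set0.
  by split=> //; rewrite indic0; exact: L1_approx_cst.
have GC B : G B -> G (~` B).
  by move=> [mB aB]; split; [exact: measurableC|exact: L1_approx_setC].
have GU (F : nat -> set vec) : (forall n, G (F n)) -> G (\bigcup_n F n).
  move=> GF; split; first by apply: bigcupT_measurable => n; have [] := GF n.
  by apply: L1_approx_bigcup => n; have [] := GF n.
suff GA : measurable `<=` G by move=> /GA[].
apply: smallest_sub; first by split => // B /GC; rewrite setTD.
move=> B; rewrite -bigcup_seq => -[i _ /=] [C mC <-]; rewrite setTI.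
(* A generator is the preimage of a Borel set under one coordinate; a second generation argument on
   the real line reduces it to open rays. *)
pose H := [set C : set R | G ((fun x : vec => x ord0 i) @^-1` C)].
have mC' : @measurable _ (measurableTypeR R) C := mC.
rewrite RGenOInfty.measurableE in mC'.
apply: (smallest_sub (_ : sigma_algebra setT H) _ mC').
  split; rewrite /H/=.
  - by rewrite preimage_set0.
  - by move=> E GE; rewrite setTD preimage_setC; exact: GC.
  - by move=> F GF; rewrite preimage_bigcup; exact: GU.
move=> _ [a ->]; rewrite /H/=.
have -> : (fun x : vec => x ord0 i) @^-1` `]a, +oo[ = [set x : vec | a < x ord0 i].
  by apply/seteqP; split=> x /=; rewrite in_itv/= andbT.
by split; [exact: measurable_ray|exact: L1_approx_ray].
Qed.

Import HBSimple.

(** An integrable function is an [L^1] limit of simple functions, which are finite combinations of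
    indicators. *)
Lemma L1_approx_integrable f : P.-integrable setT (EFin \o f) -> L1_approx f.
Proof.
move=> intf; have mf : measurable_fun [set: vec] f.
  by apply/measurable_EFinP; exact: measurable_int intf.
apply: L1_approx_lim => // e e0.
have [s [_ _ s0]] := approximation_sfun_integrable measurableT intf.
have [n sn] : exists n, (\int[P]_z `|(f z)%:E - (s n z)%:E| <= e%:E)%E.
  apply: contrapT => /forallNP H.
  have : (e%:E <= 0 :> \bar R)%E.
    rewrite -[leRHS](cvg_lim _ s0)//; apply: lime_ge; first by apply/cvg_ex; exists 0%E.
    by apply: nearW => n; rewrite ltW// ltNge; apply/negP/H.
  by rewrite lee_fin leNgt e0.
exists (s n); split => //.
have -> : (s n : vec -> R) =
    fun x => \sum_(y <- finmap.enum_fset (fset_set (range (s n)))) y * \1_(s n @^-1` [set y]) x.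
  by apply/funext => x; rewrite fimfunE fsbig_finite.
elim: (finmap.enum_fset _) => [|y l IHl].
  rewrite (_ : (fun _ => _) = fun=> 0).
    exact: L1_approx_cst.
  by apply/funext => x; rewrite big_nil.
rewrite (_ : (fun _ => _) = fun x => y * \1_(s n @^-1` [set y]) x +
    \sum_(z <- l) z * \1_(s n @^-1` [set z]) x).
  have my z : measurable_fun [set: vec] (fun x => z * \1_(s n @^-1` [set z]) x : R).
    by apply: measurable_funM => //; exact: measurable_indicR.
  apply: L1_approxD => //; first exact: measurable_sum.
  by apply: L1_approxZ; [exact: measurable_indicR|exact: L1_approx_indic].
by apply/funext => x; rewrite big_cons.
Qed.

End L1Density.

(** * The class-guided functional *)

Section ConditionalLaw.
Set Implicit Arguments.
Unset Strict Implicit.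
Context {R : realType} {D Z : nat}.
Local Notation vec := 'rV[R]_D.
Local Open Scope ereal_scope.

Lemma pushforward_probability d1 d2 (T1 : measurableType d1)
    (T2 : measurableType d2) (mu : {measure set T1 -> \bar R}) (f : T1 -> T2) :
  measurable_fun [set: T1] f -> mu [set: T1] = 1 ->
  exists m : probability T2 R, (m : set T2 -> \bar R) = pushforward mu f.
Proof.
move=> mf mu1.
pose m0 : {measure set T2 -> \bar R} :=
  measure_function_pushforward__canonical__measure_function_Measure mu mf.
have m01 : m0 [set: T2] = 1 by rewrite /m0/= /pushforward preimage_setT.
pose mixin := Measure_isProbability.Build _ _ _ m0 m01.
pose m : probability T2 R := HB.pack (m0 : set T2 -> \bar R) mixin (Measure.class m0).
by exists m.
Qed.

Lemma product_probability_setT (m1 : probability vec R) (m2 : probability 'rV[R]_Z R) :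
  (m1 \x m2) [set: vec * 'rV[R]_Z] = 1.
Proof.
rewrite -setXTT; transitivity (m1 setT * m2 setT).
  exact: product_measure1E.
by rewrite !probability_setT mule1.
Qed.

(** Applied to a component of [P] with positive weight, it provides the Radon-Nikodym density. *)
Lemma null_dominates_of_le (m P : probability vec R) (a : R) : (0 < a)%R ->
  (forall A, measurable A -> a%:E * m A <= P A) -> m `<< P.
Proof.
move=> a0 mP; apply/null_content_dominatesP => A mA PA0.
have := mP A mA; rewrite [P A]PA0 => h.
apply/eqP; rewrite eq_le measure_ge0 andbT.
by rewrite -(@lee_pmul2l _ a%:E)// mule0.
Qed.

Section OneMap.
Variables (Y : set vec) (P m : probability vec R) (S : probability 'rV[R]_Z R).
Hypotheses (mY : measurable Y) (mP : m `<< P) (mY1 : m Y = 1).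
Variables (r : vec -> \bar R).
Hypotheses (r0 : forall x, 0 <= r x) (rfin : forall x, r x \is a fin_num)
  (intr : P.-integrable [set: vec] r)
  (mr : forall A, measurable A -> m A = \int[P]_(x in A) r x).
Variables (pi : probability (vec * vec)%type R) (T : vec * 'rV[R]_Z -> vec).
Hypothesis hT : noise_map Y Y P pi S T.

Let mrf : measurable_fun [set: vec] r.
Proof. exact: measurable_int intr. Qed.

Lemma pushforward_noise_Y : pushforward (m \x S) T Y = 1.
Proof.
have [mT TY _] := hT.
have mTY : measurable (T @^-1` Y) by rewrite -[X in measurable X]setTI; exact: mT.
apply/eqP; rewrite eq_le; apply/andP; split.
  by rewrite -(product_probability_setT m S) /pushforward le_measure ?inE.
rewrite (_ : 1 = (m \x S) (Y `*` [set: 'rV[R]_Z])).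
  rewrite /pushforward le_measure ?inE//; first exact: measurableX.
  by move=> [x z] [/= Yx _]; exact: TY.
transitivity (m Y * S setT); last exact/esym/product_measure1E.
by rewrite mY1 probability_setT mule1.
Qed.

Lemma integral_fst_noise (f : vec -> \bar R) : measurable_fun [set: vec] f ->
  (forall x, 0 <= f x) -> \int[pi]_z f z.1 = \int[P]_x f x.
Proof.
move=> mf f0; have [_ _ [k [mk kE _]]] := hT.
transitivity (\int[pushforward pi fst]_x f x).
  by rewrite ge0_integral_pushforward.
apply: eq_measure_integral => A mA _; rewrite /pushforward.
transitivity (pi (A `*` setT)).
  by congr (pi _); apply/seteqP; split=> z //= [].
rewrite kE//; under eq_integral do rewrite probability_setT.
by rewrite integral_cst// mul1e.
Qed.

(* [m] has density [r] with respect to the first marginal of [pi], so the law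
   of [T] under [m \x S] is the second marginal of [r(x) pi(dx, dy)]. *)
Lemma pushforward_noiseE B : measurable B ->
  pushforward (m \x S) T B = \int[pi]_z (r z.1 * (\1_B z.2)%:E).
Proof.
move=> mB; have [mT _ [k [mk kE kT]]] := hT.
have kfin x : k x B \is a fin_num by exact: fin_num_measure.
(* The map [T (x, _)] has law [k x] outside a [P]-null set, which is [m]-null by domination. *)
transitivity (\int[m]_x k x B).
  rewrite /pushforward /product_measure1/=.
  apply: ae_eq_integral => //.
  - apply: measurable_fun_xsection.
    by rewrite -[X in measurable X]setTI; exact: mT.
  - exact: mk.
  - have [N [mN PN0 kN]] := kT.
    exists N; split=> //; first by move/null_content_dominatesP : mP; apply.
    move=> x /= H; apply: kN => /= kx; apply: H => _.
    rewrite -kx//; congr (S _); apply/seteqP.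
    by split=> z; rewrite /xsection/= inE.
transitivity (\int[P]_x (r x * k x B)).
  apply: (integral_density (g := id)) => //; last exact: mk.
  move=> A mA; apply: (etrans (mr mA)); rewrite [LHS]integral_mkcond.
  by apply: eq_integral => x _; rewrite epatch_indic.
have mB2 : measurable_fun [set: vec * vec] (fun z => (\1_B z.2 : R)%:E).
  by apply/measurable_EFinP; apply: (measurableT_comp (measurable_indic _)).
under eq_integral do rewrite muleC.
under [RHS]eq_integral do rewrite muleC.
(* With [k x B] and [\1_B z.2] as weights and [r] as integrand, only indicators of [x] remain to be
   checked, and there the claim is the disintegration of [pi]. *)
apply: (weighted_integral_eq (g1 := id) (g2 := fst)) => //.
- exact: mk.
move=> A mA; transitivity (pi (A `*` B)).
  rewrite kE// [RHS]integral_mkcond; apply: eq_integral => x _.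
  by rewrite epatch_indic.
transitivity (\int[pi]_z (\1_(A `*` B) z)%:E).
  by rewrite integral_indic ?setIT//; exact: measurableX.
apply: eq_integral => z _; rewrite !indicE in_setX -EFinM -natrM mulnb andbC//.
Qed.

Lemma integral_pushforward_noise (rho : probability vec R) (f : vec -> \bar R) :
  (rho : set vec -> \bar R) = pushforward (m \x S) T ->
  measurable_fun [set: vec] f -> (forall y, 0 <= f y) ->
  \int[rho]_y f y = \int[pi]_z (r z.1 * f z.2).
Proof.
move=> rhoE mf f0.
have mr1 : measurable_fun [set: vec * vec] (fun z => r z.1).
  exact: (measurableT_comp mrf).
apply: (integral_density (g := snd)) => // A mA.
by apply: etrans (pushforward_noiseE mA); rewrite -rhoE.
Qed.

End OneMap.
End ConditionalLaw.

(** * Weak continuity and affinity of the law in the coupling *)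

Section WeakApproximation.
Set Implicit Arguments.
Unset Strict Implicit.
Context {R : realType} {D Z : nat}.
Local Notation vec := 'rV[R]_D.

(** The test function is [g x * psi y], with [g] continuous and close to the density in [L^1(P)]. It
    is chosen before [pi] and [T]: the error is at most [C] times the [L^1(P)] distance for every
    coupling. *)
Lemma noise_law_weak_approx (Y : set vec) (P m : probability vec R)
    (S : probability 'rV[R]_Z R) (a : R) (psi : vec -> R) (C e : R) :
  measurable Y -> 0 < a -> (forall A, measurable A -> (a%:E * m A <= P A)%E) ->
  continuous psi -> measurable_fun [set: vec] psi -> (forall y, 0 <= psi y) ->
  (forall y, Y y -> psi y <= C) -> 0 <= C -> 0 < e ->
  exists2 f : vec * vec -> R, continuous f &
    forall pi T (rho : probability vec R),
      coupling Y Y P pi -> noise_map Y Y P pi S T ->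
      (rho : set vec -> \bar R) = pushforward (m \x S)%E T ->
      `|\int[rho]_(y in Y) psi y - intR pi (Y `*` Y) f| <= e.
Proof.
move=> mY a0 mPa cpsi mpsi psi0 psiC C0 e0.
have mP := null_dominates_of_le a0 mPa.
have [r [r0 rfin intr mr]] := radon_nikodym_sigma_finite (mu := P) (nu := m) mP.
pose q x := fine (r x).
have qE x : ((q x)%:E = r x)%E by rewrite fineK.
have q0 x : 0 <= q x by rewrite fine_ge0.
have intq : P.-integrable setT (EFin \o q).
  by rewrite (_ : _ \o _ = r)//; apply/funext => x; exact: qE.
have mq : measurable_fun [set: vec] q.
  by apply/measurable_EFinP; exact: measurable_int intq.
(* Dividing by [C + 1] covers the case [C = 0]. *)
have eC : 0 < e / (C + 1) by rewrite divr_gt0// ltr_wpDl.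
have [g [cg mg [G gG] qg]] := L1_approx_integrable intq eC.
exists (fun z => g z.1 * psi z.2).
  have cg1 (z : vec * vec) : {for z, continuous (g \o fst)}.
    by apply: continuous_comp; [exact: cvg_fst|exact: cg].
  have cpsi2 (z : vec * vec) : {for z, continuous (psi \o snd)}.
    by apply: continuous_comp; [exact: cvg_snd|exact: cpsi].
  by move=> z; exact: (continuousM (cg1 z) (cpsi2 z)).
move=> pi T rho cpi hT rhoE.
have mYY : measurable (Y `*` Y) by exact: measurableX.
have [piYY _] := cpi.
have mq1 : measurable_fun [set: vec * vec] (fun z => q z.1).
  exact: (measurableT_comp mq).
have mg1 : measurable_fun [set: vec * vec] (fun z => g z.1).
  exact: (measurableT_comp mg).
have mpsi2 : measurable_fun [set: vec * vec] (fun z => psi z.2).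
  exact: (measurableT_comp mpsi).
have psiY z : (Y `*` Y) z -> `|psi z.2| <= C.
  by move=> [_ Yz]; rewrite ger0_norm// psiC.
have intq1 : pi.-integrable setT (EFin \o (fun z => q z.1)).
  apply/integrableP; split; first exact/measurable_EFinP.
  have [_] := integrableP _ _ _ intq; apply: le_lt_trans.
  rewrite -(integral_fst_noise hT)//.
  by do 2 apply: measurableT_comp => //; exact/measurable_EFinP.
have intqpsi : pi.-integrable (Y `*` Y) (EFin \o (fun z => q z.1 * psi z.2)).
  apply: (@le_integrable _ _ _ _ _ _ _ (EFin \o (fun z => C * q z.1))) => //.
  - by apply/measurable_EFinP/measurable_funTS/measurable_funM.
  - move=> z Yz; rewrite /= lee_fin !normrM mulrC (ger0_norm C0).
    by apply: ler_wpM2r => //; exact: psiY.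
  - have := integrableZl mYY C (integrableS measurableT mYY (@subsetT _ _) intq1).
    by apply: eq_integrable => // z _; rewrite /= EFinM.
have intgpsi : pi.-integrable (Y `*` Y) (EFin \o (fun z => g z.1 * psi z.2)).
  apply: measurable_bounded_integrable => //.
  - by rewrite (le_lt_trans (probability_le1 _ _))// ltry.
  - exact/measurable_funTS/measurable_funM.
  - exists (G * C); split; first exact: num_real.
    move=> B GB z Yz; apply: le_trans (ltW GB); rewrite normrM.
    by apply: ler_pM => //; exact: psiY.
have -> : \int[rho]_(y in Y) psi y = \int[pi]_(z in Y `*` Y) (q z.1 * psi z.2).
  rewrite Rintegral_mkcond /Rintegral; congr fine.
  have mpY : measurable_fun [set: vec] (psi \_ Y).
    by apply/(measurable_restrictT _ mY); exact: measurable_funTS.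
  have pY0 y : 0 <= (psi \_ Y) y by rewrite patchE; case: ifP.
  rewrite (integral_pushforward_noise mP r0 rfin intr mr hT rhoE (f := EFin \o (psi \_ Y))); last 2 first.
  - exact/measurable_EFinP.
  - by move=> y; rewrite lee_fin.
  rewrite (ge0_negligible_integral (measurableC mYY))//.
  - rewrite setTD setCK; apply: eq_integral => z /set_mem[_ Yz].
    by rewrite -qE -EFinM patchE mem_set.
  - under eq_fun do rewrite -qE -EFinM.
    apply/measurable_EFinP/measurable_funM => //.
    exact: (measurableT_comp mpY).
  - by move=> z _; rewrite -qE -EFinM lee_fin mulr_ge0.
  - transitivity (1 - pi (Y `*` Y))%E; first exact: probability_setC.
    by rewrite piYY subee.
rewrite -RintegralB//.
have intd : pi.-integrable (Y `*` Y)
    (EFin \o (fun z => q z.1 * psi z.2 - g z.1 * psi z.2)).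
  by have := integrableB mYY intqpsi intgpsi; exact: eq_integrable.
apply: le_trans (le_normr_Rintegral mYY intd) _.
rewrite -lee_fin fineK; last first.
  by apply: integrable_fin_num => //; exact: integrable_norm.
have mqg : measurable_fun [set: vec] (fun x => (`|q x - g x|)%:E).
  by apply/measurable_EFinP/measurableT_comp => //; exact: measurable_funB.
apply: (@le_trans _ _ (\int[pi]_z (C%:E * (`|q z.1 - g z.1|)%:E))%E).
  apply: (@le_trans _ _ (\int[pi]_(z in Y `*` Y) (C%:E * (`|q z.1 - g z.1|)%:E))%E).
    apply: le_integral_pointwise => z Yz.
    rewrite -EFinM lee_fin -mulrBl normrM mulrC.
    by apply: ler_wpM2r => //; exact: psiY.
  apply: ge0_subset_integral => //.
    by apply: emeasurable_funM => //; exact: (measurableT_comp mqg).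
  by move=> z _; rewrite -EFinM lee_fin mulr_ge0.
rewrite ge0_integralZl//; last exact: (measurableT_comp mqg).
rewrite (integral_fst_noise hT (f := fun x => (`|q x - g x|)%:E))//.
apply: (@le_trans _ _ (C%:E * (e / (C + 1))%:E)%E).
  by rewrite lee_wpmul2l// lee_fin.
rewrite -EFinM lee_fin mulrA ler_pdivrMr; last by rewrite ltr_wpDl.
by rewrite mulrC ler_pM2l// lerDl.
Qed.

(** The potential of [nu], extended by zero outside [Y], is nonnegative and measurable, so
    [integral_mixture] applies to it. *)
Lemma cross_mixture (Y : set vec) (M : R) (m m1 m2 nu : probability vec R) (l : R) :
  measurable Y -> (forall y, Y y -> norm2 y <= M) -> nu Y = 1%E ->
  0 <= l <= 1 ->
  (forall A, measurable A -> m A = (l%:E * m1 A + (1 - l)%:E * m2 A)%E) ->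
  cross Y m nu = l * cross Y m1 nu + (1 - l) * cross Y m2 nu.
Proof.
move=> mY YM nuY l01 mE.
have bp := bounded_meas_potential mY YM nuY.
have [mp _] := bp.
have mpY : measurable_fun [set: vec] (potential Y nu \_ Y).
  by apply/(measurable_restrictT _ mY); exact: measurable_funTS.
have pY0 y : 0 <= (potential Y nu \_ Y) y.
  by rewrite patchE; case: ifP => // _; exact: potential_ge0.
have crossE (mu : probability vec R) :
    ((cross Y mu nu)%:E = \int[mu]_x ((potential Y nu \_ Y) x)%:E)%E.
  rewrite /cross fineK; last first.
    by apply: integrable_fin_num => //; exact: bounded_meas_integrable.
  by rewrite integral_mkcond; apply: eq_integral => x _; rewrite restrict_EFin.
apply: EFin_inj; rewrite EFinD !EFinM !crossE.
by apply: integral_mixture => //; exact/measurable_EFinP.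
Qed.

(** The density [r] depends on [m] and [P] alone, so all three laws integrate the same function
    against their couplings, whatever the maps [T], [T1], [T2]. *)
Lemma noise_law_mixture (Y : set vec) (P m : probability vec R)
    (S : probability 'rV[R]_Z R) (a l : R)
    (pi pi1 pi2 : probability (vec * vec)%type R) T T1 T2 A :
  0 < a -> (forall A, measurable A -> (a%:E * m A <= P A)%E) -> 0 <= l <= 1 ->
  (forall A, measurable A -> pi A = (l%:E * pi1 A + (1 - l)%:E * pi2 A)%E) ->
  noise_map Y Y P pi S T -> noise_map Y Y P pi1 S T1 -> noise_map Y Y P pi2 S T2 ->
  measurable A ->
  (pushforward (m \x S) T A = l%:E * pushforward (m \x S) T1 A +
    (1 - l)%:E * pushforward (m \x S) T2 A)%E.
Proof.
move=> a0 mPa l01 piE n n1 n2 mA.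
have mP := null_dominates_of_le a0 mPa.
have [r [r0 rfin intr mr]] := radon_nikodym_sigma_finite (mu := P) (nu := m) mP.
rewrite (pushforward_noiseE mP r0 rfin intr mr n)//.
rewrite (pushforward_noiseE mP r0 rfin intr mr n1)//.
rewrite (pushforward_noiseE mP r0 rfin intr mr n2)//.
apply: integral_mixture => //.
  apply: emeasurable_funM.
    apply: (measurableT_comp (measurable_int _ intr)) => //.
  by apply/measurable_EFinP; apply: (measurableT_comp (measurable_indic _)).
by move=> z; rewrite mule_ge0// lee_fin.
Qed.

End WeakApproximation.

(** * Convexity and lower semi-continuity of the functional *)

Section ClassGuidedFunctional.
Set Implicit Arguments.
Unset Strict Implicit.
Context {R : realType} {D Z N : nat}.
Local Notation vec := 'rV[R]_D.
Variables (Y : set vec) (P : probability vec R).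
Variables (alpha : 'I_N -> R) (Pn Qn : 'I_N -> probability vec R).
Variables (S : probability 'rV[R]_Z R).
Variable Tsel : probability (vec * vec)%type R -> vec * 'rV[R]_Z -> vec.
Hypotheses (cY : compact Y) (ha : forall n, 0 <= alpha n)
  (hsa : \sum_(n < N) alpha n = 1).
Hypotheses (hPn : forall n, Pn n Y = 1%E) (hQn : forall n, Qn n Y = 1%E).
Hypothesis hP : forall A, measurable A -> P A = (\sum_(n < N) (alpha n)%:E * Pn n A)%E.
Hypothesis hT : forall pi, coupling Y Y P pi -> noise_map Y Y P pi S (Tsel pi).

Local Notation F := (FG Y Y P alpha Pn Qn S Tsel).

Let mY : measurable Y := compact_measurable_rV cY.

Definition cross_energy (m nu : probability vec R) : R :=
  cross Y m nu - 2^-1 * cross Y m m - 2^-1 * cross Y nu nu.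

Lemma Pn_le_P n A : measurable A -> ((alpha n)%:E * Pn n A <= P A)%E.
Proof.
move=> mA; rewrite hP// (bigD1 n)//= leeDl// sume_ge0// => i _.
by rewrite mule_ge0// lee_fin.
Qed.

(** On couplings the functional is a finite real sum, and the laws become genuine probabilities to
    which the results on [cross] apply. *)
Lemma FG_couplingE pi : coupling Y Y P pi ->
  exists rho : 'I_N -> probability vec R,
    [/\ forall n, rho n Y = 1%E,
        forall n, (rho n : set vec -> \bar R) = pushforward (Pn n \x S)%E (Tsel pi) &
        F pi = (\sum_(n < N) alpha n * cross_energy (rho n) (Qn n))%:E].
Proof.
have [M M0 YM] := compact_norm2_bounded cY.
move=> cpi; have nT := hT cpi; have [mT _ _] := nT.
have /choice[rho rhoE] : forall n : 'I_N, exists m : probability vec R,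
    (m : set vec -> \bar R) = pushforward (Pn n \x S)%E (Tsel pi).
  by move=> n; apply: pushforward_probability => //; exact: product_probability_setT.
have rhoY n : rho n Y = 1%E by rewrite rhoE; exact: pushforward_noise_Y nT.
exists rho; split => //.
rewrite /FG asboolT// -sumEFin; apply: eq_bigr => n _.
by rewrite EFinM -rhoE (energy2_cross mY YM).
Qed.

Lemma FG_convex : convex_on_Pi Y Y P F.
Proof.
move=> pi1 pi2 pi l c1 c2 l01 piE.
have [M M0 YM] := compact_norm2_bounded cY.
have c : coupling Y Y P pi.
  have [c1Y c1A] := c1; have [c2Y c2A] := c2; split=> [|A mA].
    rewrite piE; last exact: measurableX.
    by rewrite c1Y c2Y !mule1 -EFinD addrC subrK.
  rewrite piE; last exact: measurableX.
  rewrite c1A// c2A// -ge0_muleDl ?lee_fin ?subr_ge0; try by case/andP: l01.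
  by rewrite -EFinD addrC subrK mul1e.
have [rho [rhoY rhoE ->]] := FG_couplingE c.
have [rho1 [rho1Y rho1E ->]] := FG_couplingE c1.
have [rho2 [rho2Y rho2E ->]] := FG_couplingE c2.
rewrite -!EFinM -EFinD lee_fin !mulr_sumr -big_split/=.
apply: ler_sum => n _; rewrite mulrCA (mulrCA (1 - l)) -mulrDr.
(* A component of weight zero contributes nothing; only the others need be dominated by [P]. *)
have := ha n; rewrite le_eqVlt => /predU1P[<-|a0]; first by rewrite !mul0r.
rewrite ler_pM2l//.
have mixE A : measurable A ->
    rho n A = (l%:E * rho1 n A + (1 - l)%:E * rho2 n A)%E.
  move=> mA; rewrite rhoE rho1E rho2E.
  exact: (noise_law_mixture a0 (@Pn_le_P n) l01 piE
    (hT c) (hT c1) (hT c2)).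
have mix (nu : probability vec R) : nu Y = 1%E ->
    cross Y (rho n) nu = l * cross Y (rho1 n) nu + (1 - l) * cross Y (rho2 n) nu.
  by move=> nuY; exact: (cross_mixture mY YM nuY l01 mixE).
have sym m1 m2 := @cross_sym _ _ _ _ mY M0 YM m1 m2.
have := cross_energy_ge0 mY M0 YM (rho1Y n) (rho2Y n).
rewrite /cross_energy !mix// (sym (rho1 n) (rho n))// (sym (rho2 n) (rho n))// !mix//.
rewrite (sym (rho2 n) (rho1 n))//.
case/andP: l01 => l0 l1.
set c12 := cross Y (rho1 n) (rho2 n); set c11 := cross Y (rho1 n) (rho1 n).
set c22 := cross Y (rho2 n) (rho2 n); set q := cross Y (Qn n) (Qn n).
set q1 := cross Y (rho1 n) _; set q2 := cross Y (rho2 n) _ => e12.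
(* The convexity defect of a quadratic form: [l * (1 - l) / 2] times the expression made nonnegative
   by [cross_energy_ge0]. *)
rewrite -subr_ge0 (_ : _ - _ = 2^-1 * (l * (1 - l)) * (2 * c12 - c11 - c22)).
  by rewrite !mulr_ge0// subr_ge0.
by field.
Qed.

(* By the previous inequality [cross_energy_ge0], [cross_energy] dominates its
   linearization at [m0], whose linear part integrates a continuous potential. *)
Lemma cross_energy_tangent (m m0 nu : probability vec R) :
  m Y = 1%E -> m0 Y = 1%E -> nu Y = 1%E ->
  cross_energy m0 nu + (cross Y m nu - cross Y m0 nu)
    - (cross Y m m0 - cross Y m0 m0) <= cross_energy m nu.
Proof.
move=> mY1 m0Y nuY; have [M M0 YM] := compact_norm2_bounded cY.
have := cross_energy_ge0 mY M0 YM mY1 m0Y; rewrite /cross_energy; lra.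
Qed.

Lemma FG_lsc : lsc_on_Pi Y Y P F.
Proof.
move=> pi0 c0 t; have [rho0 [rho0Y rho0E ->]] := FG_couplingE c0.
set v := \sum_(n < N) _; rewrite lte_fin => tv.
have [M M0 YM] := compact_norm2_bounded cY.
(* The tangent at [rho0] has two linear differences, each costing [3 * e]: two approximations and
   one weak-neighbourhood bound. The loss [6 * e] stays below [v - t = 8 * e]. *)
pose e := (v - t) / 8; have e0 : 0 < e by rewrite divr_gt0// subr_gt0.
have approx (nu : 'I_N -> probability vec R) : (forall n, nu n Y = 1%E) ->
    exists f : 'I_N -> vec * vec -> R, (forall n, continuous (f n)) /\
    forall n, 0 < alpha n -> forall pi (rho : probability vec R),
      coupling Y Y P pi ->
      (rho : set vec -> \bar R) = pushforward (Pn n \x S)%E (Tsel pi) ->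
      `|cross Y rho (nu n) - intR pi (Y `*` Y) (f n)| <= e.
  move=> nuY; suff /choice[f fP] : forall n, exists f : vec * vec -> R,
      continuous f /\ (0 < alpha n -> forall pi (rho : probability vec R),
      coupling Y Y P pi ->
      (rho : set vec -> \bar R) = pushforward (Pn n \x S)%E (Tsel pi) ->
      `|cross Y rho (nu n) - intR pi (Y `*` Y) f| <= e).
    by exists f; split=> n; have [] := fP n.
  move=> n; have := ha n; rewrite le_eqVlt => /predU1P[<-|a0].
    (* For weight zero any continuous function will do. *)
    by exists (fun=> 0); split=> [z|]; [exact: cst_continuous|rewrite ltxx].
  have [f cf fP] := noise_law_weak_approx S mY a0 (@Pn_le_P n)
    (continuous_potential mY YM (nuY n))
    (bounded_meas_potential mY YM (nuY n)).1
    (potential_ge0 Y (nu n)) (fun y Yy => potential_le mY YM (nuY n) Yy)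
    (mulr_ge0 (ler0n R 2) M0) e0.
  by exists f; split=> // _ pi rho cpi; exact: fP (hT cpi).
have [f [cf fP]] := approx Qn hQn.
have [g [cg gP]] := approx rho0 rho0Y.
(* The first [N] test functions approximate integrals of the potentials of [Qn], the last [N] those
   of [rho0]. *)
exists (N + N)%N, (fun i => match fintype.split i with inl n => f n | inr n => g n end), e.
split => // [i|pi cpi near].
  by apply: continuous_subspaceT; case: fintype.split => n; [exact: cf|exact: cg].
have [rho [rhoY rhoE ->]] := FG_couplingE cpi.
rewrite lte_fin.
have nf n : `|intR pi (Y `*` Y) (f n) - intR pi0 (Y `*` Y) (f n)| < e.
  by have := near (lshift N n); rewrite (unsplitK (inl n)).
have ng n : `|intR pi (Y `*` Y) (g n) - intR pi0 (Y `*` Y) (g n)| < e.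
  by have := near (rshift N n); rewrite (unsplitK (inr n)).
suff : v - 6 * e <= \sum_(n < N) alpha n * cross_energy (rho n) (Qn n).
  by apply: lt_le_trans; rewrite /e; lra.
have -> : v - 6 * e = \sum_(n < N) alpha n * (cross_energy (rho0 n) (Qn n) - 6 * e).
  transitivity (\sum_(n < N)
      (alpha n * cross_energy (rho0 n) (Qn n) - alpha n * (6 * e))).
    by rewrite sumrB -mulr_suml hsa mul1r.
  by apply: eq_bigr => n _; rewrite -mulrBr.
apply: ler_sum => n _.
have := ha n; rewrite le_eqVlt => /predU1P[<-|a0]; first by rewrite !mul0r.
rewrite ler_pM2l//; apply: le_trans (cross_energy_tangent (rhoY n) (rho0Y n) (hQn n)).
have := fP n a0 pi (rho n) cpi (rhoE n); have := fP n a0 pi0 (rho0 n) c0 (rho0E n).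
have := gP n a0 pi (rho n) cpi (rhoE n); have := gP n a0 pi0 (rho0 n) c0 (rho0E n).
have := nf n; have := ng n; rewrite !ltr_norml !ler_norml.
move=> /andP[? ?] /andP[? ?] /andP[? ?] /andP[? ?] /andP[? ?] /andP[? ?]; lra.
Qed.

End ClassGuidedFunctional.

(** The suprema are compared term by term: for each [pi] the same [F pi] is subtracted from ordered
    integrals. *)
Lemma conjF_sep_increasing (R : realType) (D : nat) (X Y : set 'rV[R]_D)
    (F : probability ('rV[R]_D * 'rV[R]_D)%type R -> \bar R) :
  sep_star_increasing X Y F.
Proof.
move=> u v c _ _ _ uvc; apply: ge_ereal_sup => _ [pi _ <-].
apply: le_trans (ereal_sup_ubound _); last by exists pi.
apply: leeB => //; apply: le_integral_pointwise => -[x y] [/= Xx Yy].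
by rewrite lee_fin uvc.
Qed.

Theorem theorem4 (R : realType) (D Z N : nat) (X Y : set 'rV[R]_D)
  (hX : compact X) (hXY : X = Y)
  (P Q : probability 'rV[R]_D R) (Pn Qn : 'I_N -> probability 'rV[R]_D R)
  (alpha beta : 'I_N -> R)
  (ha : forall n, 0 <= alpha n) (hb : forall n, 0 <= beta n)
  (hsa : \sum_(n < N) alpha n = 1) (hsb : \sum_(n < N) beta n = 1)
  (hPn : forall n, Pn n X = 1%E) (hQn : forall n, Qn n Y = 1%E)
  (hP : forall A, measurable A -> P A = (\sum_(n < N) (alpha n)%:E * Pn n A)%E)
  (hQ : forall A, measurable A -> Q A = (\sum_(n < N) (beta n)%:E * Qn n A)%E)
  (S : probability 'rV[R]_Z R) (hS : atomless S)
  (Tsel : probability ('rV[R]_D * 'rV[R]_D)%type R -> 'rV[R]_D * 'rV[R]_Z -> 'rV[R]_D)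
  (hT : forall pi, coupling X Y P pi -> noise_map X Y P pi S (Tsel pi)) :
  let F := FG X Y P alpha Pn Qn S Tsel in
  [/\ convex_on_Pi X Y P F, lsc_on_Pi X Y P F & sep_star_increasing X Y F].
Proof.
subst Y; split.
- exact: FG_convex hX ha hPn hQn hP hT.
- exact: FG_lsc hX ha hsa hPn hQn hP hT.
- exact: conjF_sep_increasing.
Qed.
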